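(* Let $\mathcal A$ be a unital $C^*$-algebra, let $\mathcal M$ be a countably generated Hilbert module over $\mathcal A$ and let $T\in B^a(\mathcal M)$. Then $$\chi_o^*(T)=\inf\{k\ge0\mid\chi^*(T(E))\le k\,\chi^*(E)\ \text{for each bounded set } E\subseteq\mathcal M\},$$ where $\chi_o^*(T)=\chi^*(T(B_1))$ and $B_1$ is the closed unit ball of $\mathcal M$.
   Context: $B^a(\mathcal M)$ is the set of all bounded adjointable $\mathcal A$-linear operators on $\mathcal M$. Hilbert $C^*$-modules are right modules; $\langle x,ya\rangle=\langle x,y\rangle a$ and $\|x\|=\|\langle x,x\rangle\|^{1/2}$. Bounded means norm bounded. Troitsky's seminorms. A countable system $X=\{x_i\}_{i\ge1}\subset\mathcal M$ is called $\mathcal M$-admissible if (1) for every $x\in\mathcal M$ the series $\sum_i\langle x,x_i\rangle\langle x_i,x\rangle$ converges in norm; (2) its sum is $\le\langle x,x\rangle$; (3) $\|x_i\|\le1$ for all $i$. For an $\mathcal M$-admissible $X$ and a countable collection $\Phi=\{\varphi_1,\varphi_2,\dots\}$ of states on $\mathcal A$ put $$p_{X,\Phi}(x)=\sqrt{\sup_{k}\sum_{i=k}^{\infty}|\varphi_k(\langle x,x_i\rangle)|^2},\qquad x\in\mathcal M.$$ These are seminorms with $p_{X,\Phi}(x)\le\|x\|$. Hausdorff measure. For bounded $E\subseteq\mathcal M$ and a seminorm $p=p_{X,\Phi}$, $\chi_p(E)$ is the infimum of all $\varepsilon>0$ such that there are finitely many $y_1,\dots,y_m\in\mathcal M$ with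 $E\subseteq\bigcup_{j}\{x\in\mathcal M: p(x-y_j)<\varepsilon\}$; $\chi^*(E)=\sup_{X,\Phi}\chi_{p_{X,\Phi}}(E)$ over all $\mathcal M$-admissible $X$ and all countable collections $\Phi$ of states. *)

(* Defs.v *)
From HB Require Import structures.
From mathcomp Require Import all_boot all_order all_algebra.
From mathcomp Require Import complex.
From mathcomp Require Import all_classical all_reals all_analysis.

Set Implicit Arguments.
Unset Strict Implicit.
Unset Printing Implicit Defensive.

Import Order.TTheory GRing.Theory Num.Theory.
Import numFieldNormedType.Exports.

Local Open Scope classical_set_scope.
Local Open Scope ring_scope.
Local Open Scope complex_scope.

(* Norms of normed spaces over R[i] take values in R[i]; they are real there,
   and [rnorm] is the same norm as an element of R. *)
Definition rnorm (R : realType) (V : normedModType R[i]) (v : V) : R :=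
  complex.Re `|v|.

(* Unital complex C*-algebras. MathComp-Analysis has no join of rings and
   normed modules, so the product is a field of the mixin, and the ring and
   algebra structures are declared afterwards on the sort of the structure.
   As for all MathComp rings, 1 != 0. *)
HB.mixin Record isCStarAlgebra (R : realType) A
    of CompleteNormedModule R[i] A := {
  cmul : A -> A -> A ;
  cone : A ;
  cmulA : associative cmul ;
  cmul1 : left_id cone cmul ;
  cmulr1 : right_id cone cmul ;
  cmulDl : left_distributive cmul +%R ;
  cmulDr : right_distributive cmul +%R ;
  cone_neq0 : cone != 0 ;
  cmulZl : forall (k : R[i]) a b, k *: cmul a b = cmul (k *: a) b ;
  cmulZr : forall (k : R[i]) a b, k *: cmul a b = cmul a (k *: b) ;
  cmul_norm : forall a b : A, `|cmul a b| <= `|a| * `|b| ;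
  star : A -> A ;
  starK : involutive star ;
  starD : {morph star : a b / a + b} ;
  starZ : forall (k : R[i]) a, star (k *: a) = Num.conj k *: star a ;
  starM : forall a b, star (cmul a b) = cmul (star b) (star a) ;
  star_norm : forall a : A, `|cmul (star a) a| = `|a| ^+ 2
}.

#[short(type="cstarAlgType")]
HB.structure Definition CStarAlgebra (R : realType) :=
  {A of CompleteNormedModule R[i] A & isCStarAlgebra R A}.

#[non_forgetful_inheritance]
HB.instance Definition _ (R : realType) (A : cstarAlgType R) :=
  GRing.Zmodule_isNzRing.Build (CStarAlgebra.sort A)
    (@cmulA R A) (@cmul1 R A) (@cmulr1 R A) (@cmulDl R A) (@cmulDr R A)
    (@cone_neq0 R A).

#[non_forgetful_inheritance]
HB.instance Definition _ (R : realType) (A : cstarAlgType R) :=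
  GRing.Lmodule_isLalgebra.Build R[i] (CStarAlgebra.sort A) (@cmulZl R A).

#[non_forgetful_inheritance]
HB.instance Definition _ (R : realType) (A : cstarAlgType R) :=
  GRing.Lalgebra_isAlgebra.Build R[i] (CStarAlgebra.sort A) (@cmulZr R A).

Definition cpos (R : realType) (A : cstarAlgType R) (a : A) : Prop :=
  exists b : A, a = star b * b.

Definition cle (R : realType) (A : cstarAlgType R) (a b : A) : Prop :=
  cpos (b - a).

(* Right modules. The scalar action of R[i] is the one induced by that of A
   ([ractZ]); the remaining scalar compatibilities, as well as conjugate
   linearity of [inner] in its first argument, follow. Completeness comes from
   [CompleteNormedModule], whose norm is the one of [inner] ([inner_norm]),
   so that [inner x x = 0] forces [x = 0]. *)
HB.mixin Record isHilbertModule (R : realType) (A : cstarAlgType R) M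
    of CompleteNormedModule R[i] M := {
  ract : M -> A -> M ;
  ractDl : forall x y a, ract (x + y) a = ract x a + ract y a ;
  ractDr : forall x a b, ract x (a + b) = ract x a + ract x b ;
  ractM : forall x a b, ract x (a * b) = ract (ract x a) b ;
  ractZ : forall x (k : R[i]), ract x (k *: 1) = k *: x ;
  inner : M -> M -> A ;
  innerDr : forall x y z, inner x (y + z) = inner x y + inner x z ;
  inner_ract : forall x y a, inner x (ract y a) = inner x y * a ;
  inner_star : forall x y, star (inner x y) = inner y x ;
  inner_pos : forall x, cpos (inner x x) ;
  inner_norm : forall x : M, `|x| ^+ 2 = `|inner x x|
}.

#[short(type="hilbertModType")]
HB.structure Definition HilbertModule (R : realType) (A : cstarAlgType R) :=
  {M of CompleteNormedModule R[i] M & isHilbertModule R A M}.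

Section HilbertModuleTheory.
Context (R : realType) (A : cstarAlgType R) (M : hilbertModType A).

Local Notation "<< x , y >>" := (@inner R A M x y).
Local Notation "x ** a" := (@ract R A M x a) (at level 40).

(* Finite generating systems are covered, by repeating a generator. *)
Definition countably_generated : Prop :=
  exists g : nat -> M,
    closure [set x | exists (n : nat) (a : nat -> A),
                       x = \sum_(i < n) g i ** a i] = [set: M].

Definition adjointable (T : M -> M) : Prop :=
  exists Ts : M -> M, forall x y, << T x, y >> = << x, Ts y >>.

Definition bounded_adjointable (T : M -> M) : Prop :=
  [/\ forall x y, T (x + y) = T x + T y,
      forall x a, T (x ** a) = T x ** a,
      exists C : R, forall x, rnorm (T x) <= C * rnorm x &
      adjointable T].

Definition state (phi : {scalar A}) : Prop :=
  (forall a, cpos a -> 0 <= phi a) /\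
  ereal_sup [set (Normc.normc (phi a))%:E | a in [set a : A | rnorm a <= 1]] = 1%:E.

Definition bracket_series (X : nat -> M) (x : M) : nat -> A :=
  series (fun i => << x, X i >> * << X i, x >>).

(* Finite systems are covered, by padding with 0. *)
Definition admissible (X : nat -> M) : Prop :=
  (forall x, cvgn (bracket_series X x) /\
             cle (limn (bracket_series X x)) << x, x >>) /\
  (forall i, rnorm (X i) <= 1).

(* Indices start at 0. Finite collections of states are covered: repeating
   states at larger k only adds tails of sums which already occur. *)
Definition pXPhi (X : nat -> M) (Phi : nat -> {scalar A}) (x : M) : \bar R :=
  sqrte (ereal_sup (range (fun k : nat =>
    \sum_(k <= i <oo) ((Normc.normc (Phi k << x, X i >>)) ^+ 2)%:E)%E)).

Definition chi (p : M -> \bar R) (E : set M) : \bar R :=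
  ereal_inf [set e%:E | e in [set e : R | 0 < e /\
    exists ys : seq M,
      E `<=` [set x | exists2 y, y \in ys & (p (x - y)%R < e%:E)%E]]].

Definition chi_star (E : set M) : \bar R :=
  ereal_sup [set r | exists (X : nat -> M) (Phi : nat -> {scalar A}),
    [/\ admissible X, forall k, state (Phi k) & r = chi (pXPhi X Phi) E]].

Definition chi_o_star (T : M -> M) : \bar R :=
  chi_star (T @` [set x | rnorm x <= 1]).

End HilbertModuleTheory.
Arguments countably_generated {R A} M.

(* Main.v *)
From Stdlib Require Ncring Ncring_tac.
Require Import Defs.
From HB Require Import structures.
From mathcomp Require Import all_boot all_order all_algebra.
From mathcomp Require Import complex.
From mathcomp Require Import all_classical all_reals all_analysis.
From mathcomp Require Import ring lra.

Import Order.TTheory GRing.Theory Num.Theory.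
Import numFieldNormedType.Exports.

Local Open Scope classical_set_scope.
Local Open Scope ring_scope.

Set Implicit Arguments.
Unset Strict Implicit.
Unset Printing Implicit Defensive.

(** Write [B1] for the unit ball and [l] for [chi_star (T @` B1)].

    One inequality is immediate: every [k] of the right-hand side satisfies
    [l <= k * chi_star B1 <= k], because [pXPhi X Phi] is dominated by the norm
    ([pXPhi_le_norm], [chi_star_le_bound]).

    For the other, [l] itself has to be shown to be one of the [k]. Call a set
    [r]-approximable when it lies within distance [r] of a set of combinations
    [\sum_(i < n) f_i a_i] with fixed [f_i] and uniformly bounded coefficients.
    - A bounded set [E] with [chi_star E < r] is [r]-approximable
      ([chi_star_lt_approximable]). If it is not, elements [w_0, w_1, ...] of the
      unit ball are constructed one after the other, almost orthogonal to each
      other and to more and more of the generators of [M], together with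
      [x_k] in [E] and states [phi_k] such that [r <= Re (phi_k <x_k, w_k>)].
      Almost orthogonality makes the Gram matrix of the [w_k] close to a
      contraction, so that after a slight rescaling they form an admissible
      system [X] ([exists_detecting_system]). For fixed [y] the elements
      [<y, X_k>] tend to 0, hence finitely many balls of radius smaller than
      almost [r] cannot cover the points [x_k] ([chi_ge_detected]).
      The element [w_k] is obtained from the frame operator [K] of the finitely
      many elements it must avoid: if [0 <= K <= 1] then [(1 - K)^N x] differs
      from [x] by a combination of these elements with coefficients bounded in
      terms of [N], so that its norm exceeds [r] for some [x] in [E], while its
      inner products with these elements are small ([select_orthogonal]).
    - Bounded pieces of finitely generated submodules are totally bounded for
      every [pXPhi X Phi] ([finite_rank_totally_bounded]).
    If [E] is [r]-approximable, then [T E] is contained in the sum of such a piece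
    and of [r] times [T B1], so its measure is at most [l * r]
    ([chi_image_approximable]); now let [r] decrease to [chi_star E].

    Two facts on C*-algebras enter. Elements [star b * b] form a closed cone
    (Kaplansky, [cpos_psd]); this is proved from the norm alone, positivity of a
    self-adjoint [a] being expressed as [rnorm (t - a) <= t] for some [t >= 0],
    with square roots given by an iteration. And a positive element attains its
    norm at a state ([exists_state]), by the Hahn-Banach theorem applied to
    the sublinear functional [x |-> inf_(t >= 0) (rnorm (t + x) - t)]. *)

(** * Real-valued norms and convergence *)

Section RealNorm.
Context {R : realType} {V : normedModType R[i]}.
Implicit Types (v w : V) (t : R) (k : R[i]).

Lemma normE_rnorm v : `|v| = (rnorm v)%:C%C.
Proof. by rewrite /rnorm RRe_real// ger0_real// normr_ge0. Qed.

Lemma rnorm_ge0 v : 0 <= rnorm v.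
Proof. by rewrite -ler0c -normE_rnorm normr_ge0. Qed.

Lemma rnormD v w : rnorm (v + w) <= rnorm v + rnorm w.
Proof. by rewrite -lecR rmorphD /= -!normE_rnorm ler_normD. Qed.

Lemma rnormN v : rnorm (- v) = rnorm v.
Proof. by rewrite /rnorm normrN. Qed.

Lemma rnormBC v w : rnorm (v - w) = rnorm (w - v).
Proof. by rewrite -rnormN opprB. Qed.

Lemma rnormB v w : rnorm (v - w) <= rnorm v + rnorm w.
Proof. by rewrite -(rnormN w) rnormD. Qed.

Lemma rnorm_triangle u v w : rnorm (v - w) <= rnorm (v - u) + rnorm (u - w).
Proof.
have -> : v - w = (v - u) + (u - w) by rewrite addrA subrK.
exact: rnormD.
Qed.

Lemma rnorm0 : rnorm (0 : V) = 0.
Proof. by rewrite /rnorm normr0. Qed.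

Lemma rnorm0_eq0 v : rnorm v = 0 -> v = 0.
Proof. by move=> v0; apply/normr0_eq0; rewrite normE_rnorm v0. Qed.

Lemma rnormZ k v : rnorm (k *: v) = Normc.normc k * rnorm v.
Proof.
have : `|k *: v| = `|k| * `|v| by rewrite normrZ.
rewrite !normE_rnorm normc_def => /(congr1 (@complex.Re R)).
by case: k => a b /=; rewrite mul0r subr0.
Qed.

Lemma normc_real t : Normc.normc (t%:C%C) = `|t|.
Proof. by rewrite /= expr0n addr0 sqrtr_sqr. Qed.

Lemma rnormZr t v : rnorm (t%:C%C *: v) = `|t| * rnorm v.
Proof. by rewrite rnormZ normc_real. Qed.

Lemma rnorm_sum (I : Type) (r : seq I) (P : pred I) (F : I -> V) :
  rnorm (\sum_(i <- r | P i) F i) <= \sum_(i <- r | P i) rnorm (F i).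
Proof.
elim/big_ind2: _ => //=; first by rewrite rnorm0.
by move=> x a y b xa yb; apply: le_trans (rnormD _ _) (lerD xa yb).
Qed.

(** Convergence of a sequence, with real [e]; see [rcvgP]. *)
Definition rcvg (u : nat -> V) (l : V) : Prop :=
  forall e : R, 0 < e ->
    exists N, forall n, (N <= n)%N -> rnorm (u n - l) < e.

Lemma rcvgP u l : rcvg u l <-> u @ \oo --> l.
Proof.
split=> [ul|/cvgrPdist_lt ul e e0].
  apply/cvgrPdist_lt => -[a b]; rewrite ltcE /= => /andP[/eqP -> a0].
  have [N HN] := ul _ a0; exists N => // n /= /HN.
  by rewrite rnormBC normE_rnorm -[Complex a 0]/(a%:C%C) ltcR.
have /ul[N _ HN] : 0 < e%:C%C by rewrite ltcR.
exists N => n /HN /=; by rewrite normE_rnorm ltcR rnormBC.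
Qed.

Lemma rcvg_unique u l m : rcvg u l -> rcvg u m -> l = m.
Proof.
move=> /rcvgP ul /rcvgP um.
exact: (cvg_unique _ ul um).
Qed.

End RealNorm.

Lemma rcauchy_cvg {R : realType} {V : completeNormedModType R[i]} (u : nat -> V) :
  (forall e : R, 0 < e -> exists N, forall m n, (N <= m)%N -> (N <= n)%N ->
    rnorm (u m - u n) < e) -> exists l, rcvg u l.
Proof.
move=> uC.
suff /cauchy_cvgP uc : cauchy (u @ \oo) by exists (limn u); apply/rcvgP.
apply: cauchy_exP => -[a b]; rewrite ltcE /= => /andP[/eqP -> a0].
have [N HN] := uC _ a0; exists (u N), N => // n /= Nn.
by rewrite -ball_normE /= normE_rnorm -[Complex a 0]/(a%:C%C) ltcR HN.
Qed.

Lemma bounded_incr_cauchy {R : realType} (s : nat -> R) (B : R) :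
  (forall n, s n <= s n.+1) -> (forall n, s n <= B) ->
  forall e, 0 < e -> exists N, forall n, (N <= n)%N -> s n - s N < e.
Proof.
move=> incr sB e e0.
have hs : has_sup (range s).
  by split; [exists (s 0), 0 | exists B => _ [n _ <-]].
have [_ [N _ <-] HN] := sup_adherent e0 hs; exists N => n Nn.
have : s n <= sup (range s) by apply: ub_le_sup => //; exact: hs.2.
lra.
Qed.

(** * Elementary identities in C*-algebras *)

Section CStarBasics.
Context {R : realType} {A : cstarAlgType R}.
Implicit Types (a b c d x y : A) (s t : R).

(** The algebra as an instance for the noncommutative ring tactic. *)
#[global] Instance cstar_ring_ops : @Ncring.Ring_ops A 0 1
  (fun a b => a + b) (fun a b => a * b) (fun a b => a - b) (fun a => - a) eq.
Defined.

#[global] Instance cstar_ring : Ncring.Ring (Ro := cstar_ring_ops).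
Proof.
constructor; try exact _.
all: try (by move=> a b -> c d ->).
all: try (by move=> a b ->).
all: move=> *; rewrite ?/Algebra_syntax.addition ?/Algebra_syntax.multiplication
  ?/Algebra_syntax.zero ?/Algebra_syntax.one ?/Algebra_syntax.opposite
  ?/Algebra_syntax.subtraction ?/Algebra_syntax.equality /=.
all: first [exact: add0r|exact: addrC|exact: addrA|exact: mul1r|exact: mulr1
  |exact: mulrA|exact: mulrDl|exact: mulrDr|exact: addrN|by []].
Qed.

Lemma rnormM a b : rnorm (a * b) <= rnorm a * rnorm b.
Proof. by have := cmul_norm a b; rewrite !normE_rnorm -rmorphM /= lecR. Qed.

Lemma rnorm_starM a : rnorm (star a * a) = rnorm a ^+ 2.
Proof.
have := star_norm a; rewrite !normE_rnorm -rmorphXn /= => /(congr1 (@complex.Re R)).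
by [].
Qed.

(** [starM] with the product of the ring structure. *)
Lemma starMr a b : star (a * b) = star b * star a.
Proof. exact: starM. Qed.

Lemma star0 : star (0 : A) = 0.
Proof. by apply: (addrI (star 0)); rewrite -starD !addr0. Qed.

Lemma starN a : star (- a) = - star a.
Proof. by apply: (addrI (star a)); rewrite -starD !subrr star0. Qed.

Lemma starB a b : star (a - b) = star a - star b.
Proof. by rewrite starD starN. Qed.

Lemma star1 : star (1 : A) = 1.
Proof. by have := starMr (star 1) 1; rewrite !mulr1 !starK mulr1. Qed.

Lemma rnorm_star a : rnorm (star a) = rnorm a.
Proof.
suff le x : rnorm x <= rnorm (star x).
  by apply/eqP; rewrite eq_le le andbT -{2}(starK a) le.
have [x0|] := eqVneq (rnorm x) 0; first by rewrite x0 rnorm_ge0.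
move=> xn0; have x0 : 0 < rnorm x by rewrite lt_def xn0 rnorm_ge0.
by rewrite -(ler_pM2r x0) -expr2 -rnorm_starM rnormM.
Qed.

Lemma rnorm1 : rnorm (1 : A) = 1.
Proof.
have n0 : rnorm (1 : A) != 0.
  by apply/eqP => /rnorm0_eq0/eqP; rewrite oner_eq0.
have := rnorm_starM 1; rewrite star1 mulr1 expr2 -[LHS]mulr1.
by move=> /(mulfI n0) <-.
Qed.

Lemma rnorm_starM0 a : star a * a = 0 -> a = 0.
Proof.
move=> a0; apply: rnorm0_eq0; apply/eqP; rewrite -sqrf_eq0 -rnorm_starM a0.
by rewrite rnorm0.
Qed.

Lemma rnorm_sa_sq a : star a = a -> rnorm (a * a) = rnorm a ^+ 2.
Proof. by move=> sa; rewrite -{1}sa rnorm_starM. Qed.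

(** Scalars, real ones and the imaginary unit, as elements of the algebra. *)
Definition sc t : A := t%:C%C *: 1.
Definition imag : A := ('i%C : R[i]) *: 1.

Lemma scE t a : sc t * a = t%:C%C *: a.
Proof. by rewrite /sc -scalerAl mul1r. Qed.

Lemma sc_comm t a : sc t * a = a * sc t.
Proof. by rewrite scE /sc -scalerAr mulr1. Qed.

Lemma sc0 : sc 0 = 0. Proof. by rewrite /sc scale0r. Qed.
Lemma sc1 : sc 1 = 1. Proof. by rewrite /sc scale1r. Qed.
Lemma scD s t : sc (s + t) = sc s + sc t.
Proof. by rewrite /sc rmorphD scalerDl. Qed.
Lemma scN t : sc (- t) = - sc t.
Proof. by rewrite /sc rmorphN scaleNr. Qed.
Lemma scB s t : sc (s - t) = sc s - sc t.
Proof. by rewrite scD scN. Qed.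
Lemma scM s t : sc (s * t) = sc s * sc t.
Proof. by rewrite scE /sc scalerA rmorphM. Qed.

Lemma sc_half a : sc (2^-1) * (a + a) = a.
Proof.
rewrite -{1 2}[a]mul1r -mulrDl -sc1 -scD mulrA -scM.
by rewrite (_ : 2^-1 * (1 + 1) = 1 :> R) ?sc1 ?mul1r//; field.
Qed.

Lemma rnorm_sc t : rnorm (sc t) = `|t|.
Proof. by rewrite /sc rnormZr rnorm1 mulr1. Qed.

Lemma rnorm_scM t a : rnorm (sc t * a) = `|t| * rnorm a.
Proof. by rewrite scE rnormZr. Qed.

Lemma starZr t a : star (t%:C%C *: a) = t%:C%C *: star a.
Proof. by rewrite starZ conj_Creal //; apply/complex_realP; exists t. Qed.

Lemma star_sc t : star (sc t) = sc t.
Proof. by rewrite starZr star1. Qed.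

Lemma imagE a : imag * a = ('i%C : R[i]) *: a.
Proof. by rewrite /imag -scalerAl mul1r. Qed.

Lemma imag_comm a : imag * a = a * imag.
Proof. by rewrite imagE /imag -scalerAr mulr1. Qed.

Lemma imag_sq : imag * imag = -1.
Proof. by rewrite imagE /imag scalerA -expr2 sqr_i scaleN1r. Qed.

Lemma star_imag : star imag = - imag.
Proof. by rewrite /imag starZ star1 complexiE conjCi scaleNr. Qed.

Lemma star_cart b c : star b = b -> star c = c ->
  star (b + imag * c) = b - imag * c.
Proof. by move=> sb sc'; rewrite starD starMr sb sc' star_imag imag_comm mulrN. Qed.

(** For commuting self-adjoint [b] and [c], [b^2 + c^2] is
    [(b + i c)^* (b + i c)]. *)
Lemma cart_sq b c : star b = b -> star c = c -> b * c = c * b ->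
  star (b + imag * c) * (b + imag * c) = b * b + c * c.
Proof.
move=> sb sc' bc; rewrite star_cart//.
transitivity (b * b + b * imag * c - imag * (c * b) - imag * (c * imag) * c).
  by Ncring_tac.non_commutative_ring.
rewrite -bc -(imag_comm b) -(imag_comm c) [imag * (imag * c)]mulrA imag_sq.
by Ncring_tac.non_commutative_ring.
Qed.

(** [b] is the real part of [b + i c], whose squared norm is that of
    [b^2 + c^2]. *)
Lemma rnorm_sq_le_cart b c : star b = b -> star c = c -> b * c = c * b ->
  rnorm b ^+ 2 <= rnorm (b * b + c * c).
Proof.
move=> sb sc' bc; rewrite -(cart_sq sb sc' bc) rnorm_starM.
rewrite lerXn2r ?nnegrE ?rnorm_ge0//.
set u := b + imag * c.
have -> : b = sc (2^-1) * (u + star u).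
  by rewrite star_cart// /u addrACA subrr addr0 sc_half.
rewrite rnorm_scM ger0_norm ?invr_ge0// ler_pdivrMl//.
by rewrite (le_trans (rnormD _ _))// rnorm_star mulrDl !mul1r.
Qed.

End CStarBasics.
Arguments sc {R A}.
Ltac ncring := Ncring_tac.non_commutative_ring.

(** * Square roots and the cone of positive elements *)

Section Limits.
Context {R : realType} {V W : normedModType R[i]}.

Lemma rcvg_lip (f : V -> W) (C : R) (u : nat -> V) l :
  (forall n, rnorm (f (u n) - f l) <= C * rnorm (u n - l)) ->
  rcvg u l -> rcvg (fun n => f (u n)) (f l).
Proof.
move=> fC ul e e0.
have C0 : 0 < `|C| + 1 by rewrite ltr_wpDl.
have [N HN] := ul (e / (`|C| + 1)) (divr_gt0 e0 C0).
exists N => n /HN; rewrite ltr_pdivlMr// mulrC; apply: le_lt_trans.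
apply: le_trans (fC n) _; rewrite ler_wpM2r ?rnorm_ge0//.
by rewrite (le_trans (ler_norm _))// lerDl.
Qed.

Lemma rcvg_shift (u : nat -> V) l : rcvg u l -> rcvg (fun n => u n.+1) l.
Proof. by move=> ul e /ul[N HN]; exists N => n Nn; apply: HN; exact: leqW. Qed.

Lemma rcvg_le (u : nat -> V) l a (B : R) :
  (forall n, rnorm (u n - a) <= B) -> rcvg u l -> rnorm (l - a) <= B.
Proof.
move=> uB ul; apply/ler_addgt0Pr => e /ul[N /(_ _ (leqnn N))] HN.
have := rnorm_triangle (u N) l a; rewrite [rnorm (l - u N)]rnormBC => h.
have := uB N; lra.
Qed.

End Limits.

Section SquareRoot.
Context {R : realType} {A : cstarAlgType R}.
Implicit Types (a b c d x y : A) (s t : R).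

(** Iterates for [y = (h + y^2) / 2]; their limit [y] satisfies
    [(1 - y)^2 = 1 - h]. The real sequence [sqrt_bound] is the case [h = 1],
    and dominates all the others. *)
Fixpoint sqrt_iter (h : A) (n : nat) : A :=
  if n is m.+1 then sc (2^-1) * (h + sqrt_iter h m * sqrt_iter h m) else 0.

Fixpoint sqrt_bound (n : nat) : R :=
  if n is m.+1 then 2^-1 * (1 + sqrt_bound m * sqrt_bound m) else 0.

Lemma sqrt_bound01 n : 0 <= sqrt_bound n <= 1.
Proof. by elim: n => [|n /andP[s0 s1]] /=; [lra | apply/andP; split; nra]. Qed.

Lemma sqrt_bound_incr n : sqrt_bound n <= sqrt_bound n.+1.
Proof. have := sqrt_bound01 n => /= /andP[s0 s1]; nra. Qed.

Section Iterates.
Variable h : A.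
Hypotheses (hsa : star h = h) (h1 : rnorm h <= 1).
Local Notation y := (sqrt_iter h).
Local Notation s := sqrt_bound.

Lemma sqrt_iter_sa n : star (y n) = y n.
Proof.
elim: n => [|n IH] /=; first exact: star0.
by rewrite starMr star_sc starD starMr IH hsa -sc_comm.
Qed.

Lemma sqrt_iter_le n : rnorm (y n) <= s n.
Proof.
elim: n => [|n IH] /=; first by rewrite rnorm0.
rewrite rnorm_scM ger0_norm ?invr_ge0// ler_pM2l ?invr_gt0//.
rewrite (le_trans (rnormD _ _))// lerD// (le_trans (rnormM _ _))//.
by rewrite ler_pM ?rnorm_ge0.
Qed.

Lemma sqrt_iter_dist n : rnorm (y n.+1 - y n) <= s n.+1 - s n.
Proof.
elim: n => [|n IH].
  rewrite /= subr0 mulr0 addr0 rnorm_scM ger0_norm ?invr_ge0//.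
  by rewrite subr0 mulr0 addr0 ler_pM2l ?invr_gt0.
set y1 := y n.+1 in IH *; set s1 := s n.+1 in IH *.
have -> : y n.+2 - y1 = sc (2^-1) * (y1 * (y1 - y n) + (y1 - y n) * y n).
  rewrite [y n.+2]/(sc (2^-1) * (h + y1 * y1)).
  by rewrite {3}/y1 [y n.+1]/(sc (2^-1) * (h + y n * y n)); ncring.
have -> : s n.+2 - s1 = 2^-1 * (s1 * (s1 - s n) + (s1 - s n) * s n).
  have aux (p q : R) : p = 2^-1 * (1 + q * q) ->
      2^-1 * (1 + p * p) - p = 2^-1 * (p * (p - q) + (p - q) * q).
    by move=> pq; rewrite {3}pq; ring.
  exact: aux.
rewrite rnorm_scM ger0_norm ?invr_ge0// ler_pM2l ?invr_gt0//.
rewrite (le_trans (rnormD _ _))// lerD// (le_trans (rnormM _ _))//.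
  by rewrite ler_pM ?rnorm_ge0// sqrt_iter_le.
by rewrite ler_pM ?rnorm_ge0// sqrt_iter_le.
Qed.

Lemma sqrt_iter_comm d n : d * h = h * d -> d * y n = y n * d.
Proof.
move=> dh; elim: n => [|n IH] /=; first by rewrite mulr0 mul0r.
rewrite mulrA -sc_comm -!mulrA; congr (_ * _).
by rewrite mulrDr mulrDl dh mulrA IH -mulrA IH mulrA.
Qed.

Lemma sqrt_iter_cvg : exists l, rcvg y l.
Proof.
apply: rcauchy_cvg => e e0.
have dist N n : rnorm (y (N + n) - y N) <= s (N + n) - s N.
  elim: n => [|n IH]; first by rewrite addn0 !subrr rnorm0.
  rewrite addnS (le_trans (rnorm_triangle (y (N + n)%N) _ _))//.
  by have := sqrt_iter_dist (N + n); move: IH; lra.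
have s1 n : s n <= 1 by have /andP[] := sqrt_bound01 n.
have e2 : 0 < e / 2 by rewrite divr_gt0.
have [N HN] := bounded_incr_cauchy sqrt_bound_incr s1 e2.
exists N => m n Nm Nn; apply: le_lt_trans (rnorm_triangle (y N) _ _) _.
rewrite [rnorm (y N - _)]rnormBC.
have := dist N (m - N)%N; have := dist N (n - N)%N; rewrite !subnKC// => h2 h3.
have := HN _ Nm; have := HN _ Nn; move: h2 h3; lra.
Qed.

Lemma sqrt_limit : exists l, [/\ star l = l, rnorm l <= 1,
  l + l = h + l * l & forall d, d * h = h * d -> d * l = l * d].
Proof.
have [l yl] := sqrt_iter_cvg.
have y1 n : rnorm (y n) <= 1.
  by rewrite (le_trans (sqrt_iter_le n))//; have /andP[] := sqrt_bound01 n.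
have l1 : rnorm l <= 1.
  by rewrite -[l]subr0; apply: rcvg_le (yl) => n; rewrite subr0.
exists l; split=> //.
- apply: (rcvg_unique (u := y)) (yl).
  have : rcvg (fun n => star (y n)) (star l).
    by apply: (rcvg_lip (C := 1)) (yl) => n; rewrite -starB rnorm_star mul1r.
  by under eq_fun do rewrite sqrt_iter_sa.
- have ll : l = sc 2^-1 * (h + l * l).
    apply: (rcvg_unique (rcvg_shift yl)) => /=.
    apply: (rcvg_lip (f := fun x => sc 2^-1 * (h + x * x)) (C := 1)) (yl) => n.
    have -> : sc 2^-1 * (h + y n * y n) - sc 2^-1 * (h + l * l) =
      sc 2^-1 * (y n * (y n - l) + (y n - l) * l) by ncring.
    rewrite rnorm_scM ger0_norm ?invr_ge0// mul1r ler_pdivrMl//.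
    rewrite (le_trans (rnormD _ _))// mulr_natl mulr2n lerD//.
      by rewrite (le_trans (rnormM _ _))// ler_piMl ?rnorm_ge0.
    by rewrite (le_trans (rnormM _ _))// ler_piMr ?rnorm_ge0.
  by rewrite {1 2}ll -mulrDr sc_half.
- move=> d dh; apply: (rcvg_unique (u := fun n => d * y n)).
    apply: (rcvg_lip (C := rnorm d)) (yl) => n; rewrite -mulrBr; exact: rnormM.
  under eq_fun do rewrite (sqrt_iter_comm _ dh).
  by apply: (rcvg_lip (f := fun x => x * d) (C := rnorm d)) (yl) => n;
    rewrite -mulrBl mulrC; exact: rnormM.
Qed.

End Iterates.

(** Positivity of a self-adjoint element, expressed through the norm. That it
    agrees with being of the form [b^* b] is [cpos_psd] and [psd_cpos]. *)
Definition psd a : Prop :=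
  star a = a /\ exists2 t : R, 0 <= t & rnorm (sc t - a) <= t.

Lemma psd0 : psd (0 : A).
Proof. by split; [exact: star0 | exists 0; rewrite // sc0 subrr rnorm0]. Qed.

Lemma psdD a b : psd a -> psd b -> psd (a + b).
Proof.
move=> [sa [t t0 ta]] [sb [s s0 tb]]; split; first by rewrite starD sa sb.
exists (t + s); first exact: addr_ge0.
rewrite scD opprD addrACA; exact: le_trans (rnormD _ _) (lerD ta tb).
Qed.

Lemma psdZ t a : 0 <= t -> psd a -> psd (sc t * a).
Proof.
move=> t0 [sa [s s0 ta]]; split; first by rewrite starMr sa star_sc sc_comm.
exists (t * s); first exact: mulr_ge0.
by rewrite scM -mulrBr rnorm_scM ger0_norm// ler_wpM2l.
Qed.

Lemma psd_sc t : 0 <= t -> psd (sc t).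
Proof.
move=> t0; split; first exact: star_sc.
by exists t; rewrite // subrr rnorm0.
Qed.

Lemma psd_sc_ge0 t : psd (sc t) -> 0 <= t.
Proof.
move=> [_ [s s0]]; rewrite -scB rnorm_sc ler_norml; lra.
Qed.

Lemma psd_norm_sub a : star a = a -> psd (sc (rnorm a) - a).
Proof.
move=> sa; split; first by rewrite starB star_sc sa.
by exists (rnorm a); rewrite ?rnorm_ge0// subKr.
Qed.

(** The square root of a positive element, in its bicommutant. *)
Lemma psd_sqrt a : psd a -> exists b, [/\ psd b, b * b = a &
  forall d, d * a = a * d -> d * b = b * d].
Proof.
move=> [sa [t t0 ta]].
have [t00|tn0] := eqVneq t 0.
  have a0 : a = 0.
    apply/rnorm0_eq0/eqP; rewrite eq_le rnorm_ge0 andbT.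
    by move: ta; rewrite t00 sc0 sub0r rnormN.
  by exists 0; rewrite a0 mul0r; split=> //; exact: psd0.
have tp : 0 < t by rewrite lt_def tn0 t0.
pose h := 1 - sc t^-1 * a.
have hsa : star h = h by rewrite starB star1 starMr sa star_sc -sc_comm.
have tt : sc t * sc t^-1 = 1 :> A by rewrite -scM divff// sc1.
have tt' : sc t^-1 * sc t = 1 :> A by rewrite -scM mulVf// sc1.
have h1 : rnorm h <= 1.
  have -> : h = sc t^-1 * (sc t - a) by rewrite mulrBr tt'.
  by rewrite rnorm_scM ger0_norm ?invr_ge0// ler_pdivrMl// mulr1.
have [l [sl l1 ll lC]] := sqrt_limit hsa h1.
pose q := Num.sqrt t; have q0 : 0 <= q by exact: sqrtr_ge0.
exists (sc q * (1 - l)); split.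
- apply: psdZ => //; split; first by rewrite starB star1 sl.
  by exists 1; rewrite // sc1 subKr.
- have -> : sc q * (1 - l) * (sc q * (1 - l)) = sc t * ((1 - l) * (1 - l)).
    have -> : sc t = sc q * sc q :> A by rewrite -scM -expr2 sqr_sqrtr.
    by rewrite -!mulrA; congr (_ * _); rewrite !mulrA -sc_comm.
  have -> : (1 - l) * (1 - l) = 1 - (l + l) + l * l by ncring.
  have -> : 1 - (l + l) + l * l = sc t^-1 * a by rewrite ll /h; ncring.
  by rewrite mulrA tt mul1r.
- move=> d da; have /lC dl : d * h = h * d.
    by rewrite mulrBr mulrBl mulr1 mul1r mulrA -sc_comm -!mulrA da.
  rewrite mulrA -sc_comm -!mulrA; congr (_ * _).
  by rewrite mulrBr mulrBl mulr1 mul1r dl.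
Qed.

(** With [t = rnorm (b^2)] and [c] a square root of [t - b^2] commuting with
    [b], the identity [c^2 + b^2 = t] gives [rnorm (t - b^2) <= t]. *)
Lemma psd_sq b : star b = b -> psd (b * b).
Proof.
move=> sb; have sbb : star (b * b) = b * b by rewrite starMr sb.
split=> //; exists (rnorm b ^+ 2); first exact: sqr_ge0.
set t := rnorm b ^+ 2.
have : psd (sc t - b * b).
  by rewrite /t -rnorm_sa_sq//; apply: psd_norm_sub.
move=> /psd_sqrt[c [[sc' _] cc cC]].
have bc : b * c = c * b.
  by apply: cC; rewrite mulrBr mulrBl -sc_comm mulrA.
rewrite -cc rnorm_sa_sq//.
have := rnorm_sq_le_cart sc' sb (esym bc); rewrite cc subrK rnorm_sc.
by rewrite [`|t|]ger0_norm// sqr_ge0.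
Qed.

(** Same identity, for square roots of [a] and of [t - a]. *)
Lemma psd_le_norm a t : psd a -> psd (sc t - a) -> rnorm a <= t.
Proof.
move=> pa pta; have t0 : 0 <= t.
  by apply: psd_sc_ge0; rewrite -(subrK a (sc t)); exact: psdD.
have [b [[sb _] bb bC]] := psd_sqrt pa.
have [c [[sc' _] cc cC]] := psd_sqrt pta.
have bc : b * c = c * b.
  apply: cC; rewrite mulrBr mulrBl -sc_comm; congr (_ - _).
  by apply/esym/bC; rewrite -bb.
have := rnorm_sq_le_cart sb sc' bc; rewrite -rnorm_sa_sq// bb cc.
by rewrite addrC subrK rnorm_sc ger0_norm.
Qed.

Lemma psd_norm_le a b : psd a -> psd (b - a) -> rnorm a <= rnorm b.
Proof.
move=> pa pba; apply: psd_le_norm => //.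
have [sb _] : psd b by rewrite -(subrK a b); exact: psdD.
have -> : sc (rnorm b) - a = (sc (rnorm b) - b) + (b - a).
  by rewrite addrA subrK.
by apply: psdD => //; exact: psd_norm_sub.
Qed.

(** The defining inequality of [psd a] holds for all [t >= rnorm a]. *)
Lemma psd_bound a t : psd a -> rnorm a <= t -> rnorm (sc t - a) <= t.
Proof.
move=> pa at_; have t0 : 0 <= t by rewrite (le_trans _ at_)// rnorm_ge0.
apply: psd_le_norm; last by rewrite subKr.
have -> : sc t - a = sc (t - rnorm a) + (sc (rnorm a) - a).
  by rewrite scB addrA subrK.
apply: psdD; first by apply: psd_sc; rewrite subr_ge0.
by apply: psd_norm_sub; case: pa.
Qed.

Lemma psd_closed (u : nat -> A) l : (forall n, psd (u n)) -> rcvg u l -> psd l.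
Proof.
move=> pu ul; split.
  apply: (rcvg_unique (u := u)) (ul).
  have : rcvg (fun n => star (u n)) (star l).
    by apply: (rcvg_lip (C := 1)) (ul) => n; rewrite -starB rnorm_star mul1r.
  by under eq_fun do rewrite (pu _).1.
have [N HN] := ul 1 ltr01.
pose t := rnorm l + 1; exists t; first by rewrite addr_ge0 ?rnorm_ge0.
rewrite rnormBC; apply: (rcvg_le (u := fun n => u (N + n)%N)).
  move=> n; rewrite rnormBC; apply: psd_bound => //.
  have := rnormD (u (N + n)%N - l) l; rewrite subrK.
  have := HN _ (leq_addr n N); rewrite /t; lra.
move=> e /ul[K HK]; exists K => n Kn; apply: HK.
by rewrite (leq_trans Kn)// leq_addl.
Qed.

End SquareRoot.

(** * Kaplansky's theorem *)

Section Positivity.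
Context {R : realType} {A : cstarAlgType R}.
Implicit Types (a b c d x y : A) (s t : R).

(** Equality holds; this is the fact that [rnorm a] is in the spectrum of [a]. *)
Lemma psd_norm_add a t : psd a -> 0 <= t -> t + rnorm a <= rnorm (sc t + a).
Proof.
move=> pa t0; rewrite addrC -lerBrDr; apply: psd_le_norm => //.
rewrite scB -addrA -opprD; apply: psd_norm_sub.
by rewrite starD star_sc pa.1.
Qed.

Lemma psd_mul_star_add y : psd (y * star y + star y * y).
Proof.
pose p := y + star y; pose q := imag * (y - star y).
have sp : star p = p by rewrite /p starD starK addrC.
have sq : star q = q.
  by rewrite /q starMr starB starK star_imag mulrN -imag_comm -mulrN opprB.
have -> : y * star y + star y * y = sc 2^-1 * (p * p + q * q).
  have -> : q * q = - ((y - star y) * (y - star y)).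
    rewrite /q {1}imag_comm -[LHS]mulrA [imag * (imag * _)]mulrA imag_sq.
    by rewrite mulN1r mulrN.
  set z := y * star y + _.
  have -> : p * p - (y - star y) * (y - star y) = z + z.
    by rewrite /p /z; ncring.
  by rewrite sc_half.
have h0 : 0 <= 2^-1 :> R by rewrite invr_ge0.
by apply: psdZ => //; apply: psdD; exact: psd_sq.
Qed.

(** If [s := - (star y * y)] is positive, then
    [y * (1 + s) = (1 - y * star y) * y] and [1 - y * star y] is a contraction
    when [y] is, so that [rnorm ((1 + s) * s * (1 + s)) <= rnorm s]; this
    forces [s = 0]. *)
Lemma psd_starM_opp y : psd (- (star y * y)) -> y = 0.
Proof.
suff unit (z : A) : rnorm z <= 1 -> psd (- (star z * z)) -> z = 0.
  have [y0|yn0] := eqVneq (rnorm y) 0; first by move=> _; exact: rnorm0_eq0.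
  have y0 : 0 < rnorm y by rewrite lt_def yn0 rnorm_ge0.
  move=> py; have : sc (rnorm y)^-1 * y = 0.
    apply: unit; first by rewrite rnorm_scM ger0_norm ?invr_ge0 ?rnorm_ge0// mulVf.
    have -> : - (star (sc (rnorm y)^-1 * y) * (sc (rnorm y)^-1 * y)) =
        sc (rnorm y)^-1 * (sc (rnorm y)^-1 * - (star y * y)).
      rewrite starMr star_sc -(sc_comm _ (star y)) -!mulrA.
      by rewrite [star y * (_ * y)]mulrA -(sc_comm _ (star y)) !mulrN -!mulrA.
    by do 2!(apply: psdZ; first by rewrite invr_ge0 rnorm_ge0).
  by move=> /(congr1 (fun w => sc (rnorm y) * w)); rewrite mulrA -scM divff//
    sc1 mul1r mulr0.
move=> z1; set s : A := - (star z * z) => ps.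
have zz : star z * z = - s by rewrite /s opprK.
have pzz : psd (z * star z).
  rewrite (_ : z * star z = (z * star z + star z * z) + s).
    by apply: psdD => //; exact: psd_mul_star_add.
  by rewrite /s addrK.
have le1 : rnorm (1 - z * star z) <= 1.
  rewrite -sc1; apply: psd_bound => //; apply: le_trans (rnormM _ _) _.
  by rewrite rnorm_star mulr_ile1 ?rnorm_ge0.
have zs : z * (1 + s) = (1 - z * star z) * z by rewrite /s; ncring.
have ss : rnorm s = rnorm z ^+ 2 by rewrite /s rnormN rnorm_starM.
have [q [[sq _] qq qC]] := psd_sqrt ps.
have qs : q * s = s * q by rewrite -qq mulrA.
have psss : psd (s * s * s).
  have -> : s * s * s = (q * s) * (q * s) by rewrite -qq !mulrA.
  by apply: psd_sq; rewrite starMr sq ps.1 -qs.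
have le2 : rnorm (s + (s * s + s * s)) <= rnorm s.
  have h : rnorm (s + (s * s + s * s) + s * s * s) <= rnorm s.
    have -> : s + (s * s + s * s) + s * s * s =
        - (star (z * (1 + s)) * (z * (1 + s))).
      rewrite starMr starD star1 ps.1.
      transitivity (- ((1 + s) * (star z * z) * (1 + s))); last by ncring.
      by rewrite zz; ncring.
    rewrite rnormN rnorm_starM ss zs lerXn2r ?nnegrE ?rnorm_ge0//.
    by rewrite (le_trans (rnormM _ _))// ler_piMl ?rnorm_ge0.
  apply: le_trans h; apply: psd_norm_le; last by rewrite addrC addKr.
  by apply: psdD => //; apply: psdD; apply: psd_sq; exact: ps.1.
have s0 : rnorm s = 0.
  have e : sc (8^-1) + (s + (s * s + s * s)) =
      (sc 4^-1 + s) * (sc 4^-1 + s) + (sc 4^-1 + s) * (sc 4^-1 + s).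
    have ks : s * sc 4^-1 = sc 4^-1 * s by rewrite sc_comm.
    have kk : sc 4^-1 * sc 4^-1 + sc 4^-1 * sc 4^-1 = sc 8^-1 :> A.
      by rewrite -scM -scD; congr (sc _); field.
    have k4 : sc 4^-1 + sc 4^-1 + (sc 4^-1 + sc 4^-1) = 1 :> A.
      by rewrite -!scD -sc1; congr (sc _); field.
    move: ks kk k4; set k := sc 4^-1 => ks kk k4.
    transitivity ((k * k + k * k) + (k + k + (k + k)) * s + (s * s + s * s)
                 + (s * k - k * s) + (s * k - k * s)); last by ncring.
    by rewrite kk k4 ks subrr !addr0 mul1r addrA.
  have ge0 : 0 <= 4^-1 :> R by rewrite invr_ge0.
  have := psd_norm_add ps ge0.
  set w := sc 4^-1 + s in e * => h.
  have sw : star w = w by rewrite /w starD star_sc ps.1.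
  have := rnorm_sa_sq sw => ww.
  have := rnormD (sc 8^-1) (s + (s * s + s * s)).
  rewrite e rnorm_sc ger0_norm ?invr_ge0//.
  have -> : w * w + w * w = sc 2 * (w * w).
    by rewrite (_ : 2 = 1 + 1 :> R)// scD sc1 [RHS]mulrDl mul1r.
  rewrite rnorm_scM ger0_norm// ww.
  have := rnorm_ge0 s; move: le2 h; nra.
by apply/rnorm0_eq0/eqP; rewrite -sqrf_eq0 -ss s0.
Qed.

(** Kaplansky's theorem: elements of the form [star x * x] are positive. With
    [m = sqrt (a^2)] and [n = m - a], which is twice the negative part of
    [a = star x * x], the element [y = x n] satisfies
    [star y * y = - (n^2 m)]. *)
Lemma cpos_psd a : cpos a -> psd a.
Proof.
move=> [x ax]; have sa : star a = a by rewrite ax starMr starK.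
have [m [pm mm mC]] := psd_sqrt (psd_sq sa).
have am : a * m = m * a by apply: mC; rewrite mulrA.
pose n := m - a.
have sn : star n = n by rewrite starB sa pm.1.
have na : n * a = a * n by rewrite mulrBl mulrBr am.
have nm : n * m = m * n by rewrite mulrBl mulrBr am.
have nam : n * a = - (n * m).
  apply/eqP; rewrite -addr_eq0; apply/eqP.
  transitivity (m * a - a * m + (m * m - a * a)); first by rewrite /n; ncring.
  by rewrite am mm !subrr addr0.
have [r [[sr _] rr rC]] := psd_sqrt pm.
have nr : n * r = r * n by apply: rC.
have y0 : x * n = 0.
  apply: psd_starM_opp.
  have -> : - (star (x * n) * (x * n)) = (n * r) * (n * r).
    rewrite starMr sn !mulrA -[n * star x * x]mulrA -ax na -mulrA.
    have -> : a * (n * n) = n * (n * a) by rewrite mulrA -na -!mulrA -na.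
    by rewrite nam mulrN opprK -rr -!mulrA [r * (n * r)]mulrA -nr !mulrA.
  by apply: psd_sq; rewrite starMr sr sn.
have nnm : n * n * m = 0.
  have : star (x * n) * (x * n) = 0 by rewrite y0 mulr0.
  rewrite starMr sn !mulrA -[n * star x * x]mulrA -ax nam mulNr.
  by rewrite -[n * m * n]mulrA -nm mulrA => /eqP; rewrite oppr_eq0 => /eqP.
have nnn : n * n * n = 0.
  by rewrite {3}/n mulrBr nnm -mulrA nam mulrN mulrA nnm oppr0 subrr.
have nn : n * n = 0.
  by apply: rnorm_starM0; rewrite starMr sn mulrA nnn mul0r.
have n0 : n = 0 by apply: rnorm_starM0; rewrite sn.
by rewrite (_ : a = m)//; apply/esym/eqP; rewrite -subr_eq0 -/n n0.
Qed.

Lemma psd_cpos a : psd a -> cpos a.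
Proof. by move=> /psd_sqrt[b [[sb _] bb _]]; exists b; rewrite sb. Qed.

Lemma psd_conj a d : psd a -> psd (star d * a * d).
Proof.
move=> /psd_cpos[b ->]; apply: cpos_psd; exists (b * d).
by rewrite starMr !mulrA.
Qed.

Lemma psd_starM d : psd (star d * d).
Proof. by apply: cpos_psd; exists d. Qed.

Lemma psd_starMr d : psd (d * star d).
Proof. by apply: cpos_psd; exists (star d); rewrite starK. Qed.

End Positivity.

(** * Hahn-Banach theorem and states *)

Section Sublinear.
Context {R : realType} {V : lmodType R[i]}.
Implicit Types (x y a : V) (q : V -> R) (s t : R).

(** Real sublinear functionals. Only [<=] is asked of homogeneity; equality
    follows, see [sublinearZ]. *)
Definition sublinear q : Prop :=
  (forall x y, q (x + y) <= q x + q y) /\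
  (forall t x, 0 < t -> q (t%:C%C *: x) <= t * q x).

Lemma sublinearZ q t x : sublinear q -> 0 < t -> q (t%:C%C *: x) = t * q x.
Proof.
move=> [_ qZ] t0; apply/eqP; rewrite eq_le qZ//=.
have ti : 0 < t^-1 by rewrite invr_gt0.
have := qZ _ (t%:C%C *: x) ti; rewrite scalerA -rmorphM mulVf ?gt_eqF// scale1r.
by rewrite -ler_pdivrMl// mulrC invrK mulrC.
Qed.

Lemma sublinear0 q : sublinear q -> q 0 = 0.
Proof.
move=> sq; have := sublinearZ 0 sq (ltr0n _ 2); rewrite scaler0; lra.
Qed.

Lemma sublinear_opp q x : sublinear q -> - q (- x) <= q x.
Proof.
by move=> sq; have := sq.1 x (- x); rewrite subrr sublinear0//; lra.
Qed.

(** The largest sublinear functional below [q] with value at most [- q a] at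
    [- a]. *)
Definition sublinear_shrink q a x : R :=
  inf [set r | exists2 t, 0 <= t & r = q (x + t%:C%C *: a) - t * q a].

Section Shrink.
Variables (q : V -> R) (a : V).
Hypothesis sq : sublinear q.

Let E x := [set r | exists2 t, 0 <= t & r = q (x + t%:C%C *: a) - t * q a].

Let lbE x : lbound (E x) (- q (- x)).
Proof.
move=> _ [t t0 ->].
have : t * q a <= q (x + t%:C%C *: a) + q (- x).
  move: t0; rewrite le_eqVlt => /predU1P[<-|t0].
    rewrite mul0r scale0r addr0.
    by have := sublinear_opp x sq; lra.
  rewrite -(sublinearZ a sq t0); apply: le_trans (sq.1 _ _).
  by rewrite addrAC subrr add0r.
by lra.
Qed.

Lemma sublinear_shrink_le x t : 0 <= t ->
  sublinear_shrink q a x <= q (x + t%:C%C *: a) - t * q a.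
Proof.
move=> t0; apply: ge_inf; first by exists (- q (- x)); exact: lbE.
by exists t.
Qed.

Lemma le_sublinear_shrink x r :
  (forall t, 0 <= t -> r <= q (x + t%:C%C *: a) - t * q a) ->
  r <= sublinear_shrink q a x.
Proof.
move=> rq; apply: lb_le_inf; first by exists (q (x + (0%:C)%C *: a) - 0 * q a), 0.
by move=> _ [t t0 ->]; exact: rq.
Qed.

Lemma sublinear_shrink_le_id x : sublinear_shrink q a x <= q x.
Proof.
have := sublinear_shrink_le x (lexx 0).
by rewrite scale0r addr0 mul0r subr0.
Qed.

Lemma sublinear_shrink_sublinear : sublinear (sublinear_shrink q a).
Proof.
split=> [x y|t x t0].
  rewrite -lerBlDr; apply: le_sublinear_shrink => t t0.
  rewrite lerBlDr [leRHS]addrC -lerBlDr; apply: le_sublinear_shrink => s s0.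
  rewrite lerBlDr; apply: le_trans (sublinear_shrink_le (x + y) (addr_ge0 t0 s0)) _.
  rewrite rmorphD scalerDl addrACA.
  have := sq.1 (x + t%:C%C *: a) (y + s%:C%C *: a); lra.
rewrite -ler_pdivrMl//; apply: le_sublinear_shrink => s s0.
rewrite ler_pdivrMl//.
apply: le_trans (sublinear_shrink_le _ (mulr_ge0 (ltW t0) s0)) _.
by rewrite mulrBr -(sublinearZ _ sq t0) scalerDr scalerA rmorphM mulrA.
Qed.

End Shrink.

(** A pointwise minimal sublinear functional is linear, so Zorn's lemma applied
    downwards gives a linear functional below any given sublinear one. *)
Lemma hahn_banach q : sublinear q -> exists f : V -> R,
  [/\ forall x, f x <= q x, forall x y, f (x + y) = f x + f y &
      forall t x, f (t%:C%C *: x) = t * f x].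
Proof.
move=> sq; pose P p := sublinear p /\ forall x, p x <= q x.
pose T := {p : V -> R | P p}.
pose le (p r : T) : bool := `[< forall x, sval r x <= sval p x >].
have [| | | |[f [sf fq]] /= fmin] := @Zorn T le.
- by move=> p; apply/asboolP.
- move=> p r s /asboolP pr /asboolP rs; apply/asboolP => x.
  exact: le_trans (rs x) (pr x).
- move=> [p Pp] [r Pr] /asboolP /= pr /asboolP /= rp.
  have e : p = r by apply/funext => x; apply/eqP; rewrite eq_le pr rp.
  by subst r; congr exist; exact: Prop_irrelevance.
- move=> C Ctot; have [[p0 Cp0]|C0] := pselect (C !=set0); last first.
    exists (exist _ q (conj sq (fun=> lexx _))) => p Cp.
    by case: C0; exists p.
  pose E x := [set sval p x | p in C].
  have lbE x : has_lbound (E x).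
    exists (- q (- x)) => _ [[p [sp pq]] _ <-] /=.
    by have := sublinear_opp x sp; have := pq (- x); lra.
  have E0 x : E x !=set0 by exists (sval p0 x), p0.
  have Qle x p : C p -> inf (E x) <= sval p x.
    by move=> Cp; apply: ge_inf => //; exists p.
  have Qs : sublinear (fun x => inf (E x)).
    split=> [x y|t x t0].
      rewrite -lerBlDr; apply: lb_le_inf => // _ [p Cp <-].
      rewrite lerBlDr [leRHS]addrC -lerBlDr; apply: lb_le_inf => // _ [r Cr <-].
      rewrite lerBlDr; have [/asboolP pr|/asboolP rp] := Ctot _ _ Cp Cr.
        apply: le_trans (Qle _ _ Cr) _; apply: le_trans ((svalP r).1.1 _ _) _.
        by have := pr x; lra.
      apply: le_trans (Qle _ _ Cp) _; apply: le_trans ((svalP p).1.1 _ _) _.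
      by have := rp y; lra.
    rewrite -ler_pdivrMl//; apply: lb_le_inf => // _ [p Cp <-].
    rewrite ler_pdivrMl//; apply: le_trans (Qle _ _ Cp) _.
    exact: (svalP p).1.2.
  have QP : P (fun x => inf (E x)).
    by split=> // x; apply: le_trans (Qle _ _ Cp0) _; exact: (svalP p0).2.
  by exists (exist _ _ QP) => p Cp; apply/asboolP => x /=; exact: Qle.
have fD x y : f (x + y) = f x + f y.
  have sP : P (sublinear_shrink f y).
    split=> [|z]; first exact: sublinear_shrink_sublinear.
    exact: le_trans (sublinear_shrink_le_id _ sf _) (fq _).
  have /fmin/(congr1 sval)/= e : le (exist _ f (conj sf fq)) (exist _ _ sP).
    by apply/asboolP => z /=; exact: sublinear_shrink_le_id.
  apply/eqP; rewrite eq_le sf.1 /=.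
  have := sublinear_shrink_le y sf x ler01; rewrite e scale1r mul1r; lra.
have fN x : f (- x) = - f x.
  by have := fD x (- x); rewrite subrr sublinear0//; lra.
exists f; split=> // t x; have [t0|t0|->] := ltgtP t 0.
- have nt : 0 < - t by rewrite oppr_gt0.
  by have := sublinearZ x sf nt; rewrite rmorphN scaleNr fN; lra.
- exact: sublinearZ.
- by rewrite scale0r sublinear0// mul0r.
Qed.

End Sublinear.

Section States.
Context {R : realType} {A : cstarAlgType R}.
Implicit Types (a b x y : A) (s t : R) (phi : {scalar A}).

Lemma normc_le_rnorm phi : state phi -> forall a, Normc.normc (phi a) <= rnorm a.
Proof.
move=> [_ sup1] a; have [a0|an0] := eqVneq (rnorm a) 0.
  by rewrite (rnorm0_eq0 a0) linear0 rnorm0 Normc.normc0.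
have a0 : 0 < rnorm a by rewrite lt_def an0 rnorm_ge0.
have : ((Normc.normc (phi (((rnorm a)^-1)%:C%C *: a)))%:E <= 1%:E)%E.
  rewrite -sup1; apply: ereal_sup_ubound; exists (((rnorm a)^-1)%:C%C *: a) => //=.
  by rewrite rnormZr ger0_norm ?invr_ge0 ?rnorm_ge0// mulVf.
rewrite lee_fin linearZ /= Normc.normcM normc_real.
by rewrite ger0_norm ?invr_ge0 ?rnorm_ge0// ler_pdivrMl// mulr1.
Qed.

Lemma state_ge0 phi a : state phi -> psd a -> 0 <= phi a.
Proof. by move=> [phi0 _] /psd_cpos/phi0. Qed.

Lemma state_Re_ge0 phi a : state phi -> psd a -> 0 <= complex.Re (phi a).
Proof. by move=> sphi /(state_ge0 sphi); rewrite lecE => /andP[]. Qed.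

Lemma state_Re_le phi a b : state phi -> psd (b - a) ->
  complex.Re (phi a) <= complex.Re (phi b).
Proof.
move=> sphi /(state_Re_ge0 sphi); rewrite raddfB /=.
by case: (phi b) (phi a) => [r u] [v w] /=; rewrite subr_ge0.
Qed.

Lemma Re_le_normc (z : R[i]) : complex.Re z <= Normc.normc z.
Proof.
case: z => r u /=; rewrite (le_trans (ler_norm r))// -sqrtr_sqr.
by rewrite ler_wsqrtr// lerDl sqr_ge0.
Qed.

Lemma state_real phi a : state phi -> star a = a -> complex.Im (phi a) = 0.
Proof.
move=> sphi sa; have := state_ge0 sphi (psd_norm_sub sa).
have := state_ge0 sphi (psd_sc (rnorm_ge0 a)).
rewrite raddfB !lecE /= => /andP[/eqP + _] /andP[/eqP + _].
by case: (phi a) (phi (sc _)) => [r u] [v w] /=; lra.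
Qed.

Lemma state_star phi a : state phi -> phi (star a) = conjc (phi a).
Proof.
move=> sphi; have h1 : complex.Im (phi (a + star a)) = 0.
  by apply: state_real => //; rewrite starD starK addrC.
have h2 : complex.Im (phi (imag * (a - star a))) = 0.
  apply: state_real => //.
  by rewrite starMr starB starK star_imag mulrN -imag_comm -mulrN opprB.
move: h1 h2; rewrite imagE linearZ linearB linearD /=.
case: (phi a) (phi (star a)) => [r u] [v w] /= h1 h2.
by apply/eqP; rewrite eq_complex /=; apply/andP; split; apply/eqP; lra.
Qed.

(** The Cauchy-Schwarz (Kadison) inequality for states. *)
Lemma state_cauchy_schwarz phi a : state phi ->
  Normc.normc (phi a) ^+ 2 <= complex.Re (phi (a * star a)).
Proof.
move=> sphi; pose k := phi a; pose z := a - k *: 1.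
have := state_Re_ge0 sphi (psd_starMr z).
have -> : z * star z =
    a * star a - conjc k *: a - k *: star a + (k * conjc k) *: 1.
  have -> : star z = star a - conjc k *: 1 by rewrite starB starZ star1.
  transitivity (a * star a - a * (conjc k *: 1) - (k *: 1) * star a
                + (k *: 1) * (conjc k *: 1)); first by rewrite /z; ncring.
  by rewrite -!scalerAr mulr1 -!scalerAl mul1r mulr1 scalerA [conjc k * k]mulrC.
have : Normc.normc (phi 1) <= 1 by rewrite -(@rnorm1 R A); exact: normc_le_rnorm.
move=> /(le_trans (Re_le_normc _)).
have := state_Re_ge0 sphi (psd_sc (A := A) ler01); rewrite sc1.
rewrite linearD !linearB /= !linearZ /= (state_star _ sphi) -/k.
case: (phi (a * star a)) (phi 1) (k) => [r u] [v w] [m n] /= v0 v1.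
rewrite [_ ^+ 2]sqr_sqrtr; last by rewrite addr_ge0 ?sqr_ge0.
have : 0 <= (m ^+ 2 + n ^+ 2) * (1 - v).
  by apply: mulr_ge0; rewrite ?subr_ge0// addr_ge0 ?sqr_ge0.
nra.
Qed.

(** The largest real part of the numerical range. *)
Definition num_range_sup x : R :=
  inf [set r | exists2 t, 0 <= t & r = rnorm (sc t + x) - t].

Lemma num_range_sup_le x t : 0 <= t -> num_range_sup x <= rnorm (sc t + x) - t.
Proof.
move=> t0; apply: ge_inf; last by exists t.
exists (- rnorm x) => _ [s s0 ->].
have := rnormD (sc s + x) (- x); rewrite addrK rnormN rnorm_sc ger0_norm//.
lra.
Qed.

Lemma le_num_range_sup x r :
  (forall t, 0 <= t -> r <= rnorm (sc t + x) - t) -> r <= num_range_sup x.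
Proof.
move=> rq; apply: lb_le_inf; first by exists (rnorm (sc 0 + x) - 0), 0.
by move=> _ [t t0 ->]; exact: rq.
Qed.

Lemma num_range_sup_sublinear : sublinear num_range_sup.
Proof.
split=> [x y|t x t0].
  rewrite -lerBlDr; apply: le_num_range_sup => t t0.
  rewrite lerBlDr [leRHS]addrC -lerBlDr; apply: le_num_range_sup => s s0.
  rewrite lerBlDr; apply: le_trans (num_range_sup_le _ (addr_ge0 t0 s0)) _.
  rewrite scD addrACA; have := rnormD (sc t + x) (sc s + y); lra.
rewrite -ler_pdivrMl//; apply: le_num_range_sup => s s0.
rewrite ler_pdivrMl//; apply: le_trans (num_range_sup_le _ (mulr_ge0 (ltW t0) s0)) _.
by rewrite scM -scE -mulrDr rnorm_scM gtr0_norm// mulrBr.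
Qed.

Lemma num_range_sup_norm x : num_range_sup x <= rnorm x.
Proof. by have := num_range_sup_le x (lexx 0); rewrite sc0 add0r subr0. Qed.

Lemma num_range_sup_psdN a : psd a -> num_range_sup (- a) <= 0.
Proof.
move=> pa; apply: le_trans (num_range_sup_le _ (rnorm_ge0 a)) _.
by rewrite subr_le0 psd_bound.
Qed.

Lemma num_range_sup_psd a : psd a -> rnorm a <= num_range_sup a.
Proof.
move=> pa; apply: le_num_range_sup => t t0.
by rewrite lerBrDl; exact: psd_norm_add.
Qed.

(** For self-adjoint [a], [rnorm (t + i a) ^+ 2 = rnorm (t^2 + a^2)] exceeds [t^2]
    by a bounded amount. *)
Lemma num_range_sup_imag a : star a = a -> num_range_sup (imag * a) <= 0.
Proof.
move=> sa; apply/ler_addgt0Pr => e e0; rewrite add0r.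
pose t := rnorm a ^+ 2 / e.
have t0 : 0 <= t by rewrite divr_ge0 ?sqr_ge0// ltW.
apply: le_trans (num_range_sup_le _ t0) _; rewrite lerBlDl.
have te : 0 <= t + e by rewrite addr_ge0// ltW.
rewrite -(ler_pXn2r (n := 2)) ?nnegrE ?rnorm_ge0//.
rewrite -rnorm_starM cart_sq ?star_sc// ?sc_comm//.
rewrite -scM (le_trans (rnormD _ _))// rnorm_sa_sq// rnorm_sc.
rewrite ger0_norm; last exact: mulr_ge0.
have -> : rnorm a ^+ 2 = t * e by rewrite /t divfK// gt_eqF.
nra.
Qed.

(** A positive element attains its norm at a state. *)
Lemma exists_state a : psd a ->
  exists phi : {scalar A}, state phi /\ rnorm a <= complex.Re (phi a).
Proof.
move=> pa; have sq := num_range_sup_sublinear.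
have [f [fle fD fZ]] := hahn_banach (sublinear_shrink_sublinear a sq).
have fq x : f x <= num_range_sup x.
  exact: le_trans (fle x) (sublinear_shrink_le_id _ sq _).
have f0 : f 0 = 0 by have := fD 0 0; rewrite addr0; lra.
have fN x : f (- x) = - f x by have := fD x (- x); rewrite subrr f0; lra.
have fa : rnorm a <= f a.
  have := le_trans (fle (- a)) (sublinear_shrink_le a sq (- a) ler01).
  rewrite scale1r addNr mul1r sublinear0// fN.
  by have := num_range_sup_psd pa; lra.
have fpos x : psd x -> 0 <= f x.
  by move=> px; have := le_trans (fq _) (num_range_sup_psdN px); rewrite fN; lra.
have fim x : star x = x -> f (imag * x) = 0.
  move=> sx; have h1 := le_trans (fq _) (num_range_sup_imag sx).
  have sNx : star (- x) = - x by rewrite starN sx.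
  have h2 := le_trans (fq _) (num_range_sup_imag sNx).
  by move: h2; rewrite mulrN fN; lra.
pose g x : R[i] := Complex (f x) (- f (imag * x)).
have gD x y : g (x + y) = g x + g y.
  by apply/eqP; rewrite eq_complex /= mulrDr !fD opprD !eqxx.
have gZ k x : g (k *: x) = k * g x.
  case: k => u v.
  have -> : Complex u v *: x = (u%:C)%C *: x + (v%:C)%C *: (imag * x).
    rewrite imagE scalerA -scalerDl; congr (_ *: _).
    by apply/eqP; rewrite eq_complex /=; apply/andP; split; apply/eqP; ring.
  have -> : g ((u%:C)%C *: x + (v%:C)%C *: (imag * x)) =
      Complex (u * f x + v * f (imag * x)) (- (u * f (imag * x) - v * f x)).
    rewrite /g mulrDr -!scalerAr mulrA imag_sq mulN1r !fD !fZ fN.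
    by congr Complex; ring.
  by apply/eqP; rewrite eq_complex /=; apply/andP; split; apply/eqP; ring.
have glin : scalar g by move=> k x y; rewrite gD gZ.
pose phi : {scalar A} := HB.pack g (GRing.isLinear.Build R[i] A R[i] *%R g glin).
have gnorm x : Normc.normc (g x) <= rnorm x.
  have [g0|gn0] := eqVneq (Normc.normc (g x)) 0; first by rewrite g0 rnorm_ge0.
  have gp : 0 < Normc.normc (g x).
    by rewrite lt_def gn0 /g /= sqrtr_ge0.
  pose k := conjc (g x).
  have nk : Normc.normc k = Normc.normc (g x).
    by rewrite /k; case: (g x) => u v /=; rewrite sqrrN.
  have ek : complex.Re (g (k *: x)) = Normc.normc (g x) ^+ 2.
    rewrite gZ /k; case: (g x) => u v /=; rewrite sqr_sqrtr ?addr_ge0 ?sqr_ge0//.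
    by ring.
  have : complex.Re (g (k *: x)) <= rnorm (k *: x).
    by rewrite /= (le_trans (fq _))// num_range_sup_norm.
  by rewrite ek rnormZ nk expr2 ler_pM2l.
have g1 : Normc.normc (g 1) = 1.
  apply/eqP; rewrite eq_le; apply/andP; split; first by rewrite -(@rnorm1 R A).
  apply: le_trans (Re_le_normc _) => /=.
  have : num_range_sup (-1) <= -1.
    apply: le_trans (num_range_sup_le _ ler01) _.
    by rewrite sc1 subrr rnorm0 sub0r.
  by move=> /(le_trans (fq _)); rewrite fN lerN2.
exists phi; split=> //; split.
  move=> x /cpos_psd px; rewrite lecE /= fpos// andbT fim ?oppr0//.
  by case: px.
apply/eqP; rewrite eq_le; apply/andP; split.
  apply: ge_ereal_sup => _ [x /= x1 <-].
  by rewrite lee_fin (le_trans (gnorm _)).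
by rewrite -{1}g1; apply: ereal_sup_ubound; exists 1; rewrite //= rnorm1.
Qed.

End States.

(** * Inner products and frame operators *)

Section HilbertModule.
Context {R : realType} {A : cstarAlgType R} {M : hilbertModType A}.
Implicit Types (x y z u v w : M) (a b c d g : A) (s t : R).

Local Notation "<< x , y >>" := (@inner R A M x y).
Local Notation "x ** a" := (@ract R A M x a) (at level 40).

Lemma innerDl x y z : << x + y, z >> = << x, z >> + << y, z >>.
Proof. by rewrite -!(inner_star z) innerDr starD. Qed.

Lemma inner0r x : << x, 0 >> = 0.
Proof. by apply: (addrI << x, 0 >>); rewrite -innerDr !addr0. Qed.

Lemma inner0l x : << 0, x >> = 0.
Proof. by rewrite -inner_star inner0r star0. Qed.

Lemma innerNr x y : << x, - y >> = - << x, y >>.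
Proof. by apply: (addrI << x, y >>); rewrite -innerDr !subrr inner0r. Qed.

Lemma innerNl x y : << - x, y >> = - << x, y >>.
Proof. by rewrite -inner_star innerNr starN inner_star. Qed.

Lemma innerBr x y z : << x, y - z >> = << x, y >> - << x, z >>.
Proof. by rewrite innerDr innerNr. Qed.

Lemma innerBl x y z : << x - y, z >> = << x, z >> - << y, z >>.
Proof. by rewrite innerDl innerNl. Qed.

Lemma inner_sumr x n (f : 'I_n -> M) :
  << x, \sum_(i < n) f i >> = \sum_(i < n) << x, f i >>.
Proof.
elim/big_ind2: _ => [|y a z b <- <-|//]; first exact: inner0r.
exact: innerDr.
Qed.

Lemma inner_suml x n (f : 'I_n -> M) :
  << \sum_(i < n) f i, x >> = \sum_(i < n) << f i, x >>.
Proof.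
elim/big_ind2: _ => [|y a z b <- <-|//]; first exact: inner0l.
exact: innerDl.
Qed.

Lemma inner_ractl x y a : << x ** a, y >> = star a * << x, y >>.
Proof. by rewrite -inner_star inner_ract starMr inner_star. Qed.

Lemma ract_sc x t : x ** sc t = t%:C%C *: x.
Proof. exact: ractZ. Qed.

Lemma innerZr x y t : << x, t%:C%C *: y >> = sc t * << x, y >>.
Proof. by rewrite -ract_sc inner_ract sc_comm. Qed.

Lemma innerZl x y t : << t%:C%C *: x, y >> = sc t * << x, y >>.
Proof. by rewrite -ract_sc inner_ractl star_sc. Qed.

Lemma rnorm_inner x : rnorm << x, x >> = rnorm x ^+ 2.
Proof.
have := inner_norm x; rewrite !normE_rnorm -rmorphXn /=.
by move=> /(congr1 (@complex.Re R)) /= <-.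
Qed.

Lemma rnorm_innerC x y : rnorm << x, y >> = rnorm << y, x >>.
Proof. by rewrite -inner_star rnorm_star. Qed.

Lemma psd_inner x : psd << x, x >>.
Proof. exact/cpos_psd/inner_pos. Qed.

Lemma rnorm_ract x a : rnorm (x ** a) <= rnorm x * rnorm a.
Proof.
rewrite -(ler_pXn2r (n := 2)) ?nnegrE ?mulr_ge0 ?rnorm_ge0//.
rewrite -rnorm_inner inner_ract inner_ractl exprMn -rnorm_inner.
apply: le_trans (rnormM _ _) _; apply: le_trans (ler_wpM2r (rnorm_ge0 _) (rnormM _ _)) _.
by rewrite rnorm_star [rnorm a * _]mulrC -mulrA -expr2.
Qed.

Lemma psd_sum (I : Type) (r : seq I) (P : pred I) (F : I -> A) :
  (forall i, P i -> psd (F i)) -> psd (\sum_(i <- r | P i) F i).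
Proof. by move=> PF; elim/big_ind: _ => //; [exact: psd0 | exact: psdD]. Qed.

(** [a^* g b + b^* g^* a <= rnorm g (a^* a + b^* b)], from the positivity of
    [d^* d] and of [b^* (t^2 - g^* g) b], where [t = rnorm g] and
    [d = t a - g b]. *)
Lemma psd_cross a b g :
  psd (sc (rnorm g) * (star a * a + star b * b)
       - (star a * g * b + star b * star g * a)).
Proof.
have [g0|gn0] := eqVneq (rnorm g) 0.
  rewrite (rnorm0_eq0 g0) rnorm0 sc0 mul0r star0 !mulr0 !mul0r addr0 subr0.
  exact: psd0.
have gp : 0 < rnorm g by rewrite lt_def gn0 rnorm_ge0.
set t := rnorm g in gn0 gp *; pose d := sc t * a - g * b.
have pn : psd (sc (t ^+ 2) - star g * g).
  by rewrite /t -rnorm_starM; apply: psd_norm_sub; rewrite starMr starK.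
have : psd (sc t^-1 * (star d * d + star b * (sc (t ^+ 2) - star g * g) * b)).
  by apply: psdZ; [rewrite invr_ge0 ltW | apply: psdD;
    [exact: psd_starM | exact: psd_conj]].
suff -> : star d * d + star b * (sc (t ^+ 2) - star g * g) * b =
    sc t * (sc t * (star a * a + star b * b) - (star a * g * b + star b * star g * a)).
  by rewrite mulrA -scM mulVf// sc1 mul1r.
rewrite /d starB !starMr star_sc expr2 scM.
have e : star b * (sc t * sc t - star g * g) * b =
    sc t * sc t * (star b * b) - star b * star g * g * b.
  rewrite mulrBr mulrBl -scM -(sc_comm _ (star b)) scM.
  by rewrite !mulrA.
rewrite e -(sc_comm _ (star a)) mulrBr !mulrBl.
have -> : sc t * star a * (sc t * a) = sc t * sc t * (star a * a).
  by rewrite -!mulrA; congr (_ * _); rewrite !mulrA -sc_comm.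
have -> : star b * star g * (sc t * a) = sc t * (star b * star g * a).
  by rewrite mulrA -sc_comm !mulrA.
by ncring.
Qed.

(** The frame operator [x |-> \sum_i f_i <f_i, x>] of [n] elements, and its
    quadratic form. *)
Definition frame (f : nat -> M) n x : M := \sum_(i < n) f i ** << f i, x >>.
Definition qframe (f : nat -> M) n x : A :=
  \sum_(i < n) << x, f i >> * << f i, x >>.

Section Frame.
Variables (f : nat -> M) (n : nat).
Local Notation K := (frame f n).
Local Notation q := (qframe f n).

Lemma inner_frame x y : << x, K y >> = \sum_(i < n) << x, f i >> * << f i, y >>.
Proof. by rewrite inner_sumr; apply: eq_bigr => i _; exact: inner_ract. Qed.

Lemma inner_framel x y : << K x, y >> = << x, K y >>.
Proof.
rewrite inner_frame inner_suml; apply: eq_bigr => i _.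
by rewrite inner_ractl inner_star.
Qed.

Lemma frameB x y : K (x - y) = K x - K y.
Proof.
have ractNr z a : z ** (- a) = - (z ** a).
  apply: (addrI (z ** a)); rewrite -ractDr !subrr.
  by apply: (addrI (z ** 0)); rewrite -ractDr !addr0.
by rewrite -sumrB; apply: eq_bigr => i _; rewrite innerBr ractDr ractNr.
Qed.

Lemma qframe_term i x : (i < n)%N ->
  psd (q x - << x, f i >> * << f i, x >>).
Proof.
move=> ilt; have -> : q x = << x, f i >> * << f i, x >> +
    \sum_(j < n | j != Ordinal ilt) << x, f j >> * << f j, x >>.
  by rewrite /qframe (bigD1 (Ordinal ilt)).
rewrite [X in psd (X - _)]addrC addrK.
by apply: psd_sum => j _; rewrite -inner_star; exact: psd_starM.
Qed.

Lemma psd_qframe x : psd (q x).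
Proof. by apply: psd_sum => j _; rewrite -inner_star; exact: psd_starM. Qed.

Lemma rnorm_qframe_term i x : (i < n)%N ->
  rnorm << f i, x >> ^+ 2 <= rnorm (q x).
Proof.
move=> ilt; rewrite -rnorm_starM inner_star; apply: psd_norm_le.
  by rewrite -inner_star; exact: psd_starM.
exact: qframe_term.
Qed.

(** Schur's test on the Gram matrix [<f_i, f_j>]. *)
Lemma frame_schur (B : R) : (forall i : 'I_n, \sum_(j < n) rnorm << f i, f j >> <= B) ->
  forall x, psd (sc B * q x - << K x, K x >>).
Proof.
move=> hB x; pose c (i : 'I_n) := << f i, x >>; pose g (i j : 'I_n) := << f i, f j >>.
pose X i j := star (c i) * g i j * c j.
have KK : << K x, K x >> = \sum_i \sum_j X i j.
  rewrite inner_suml; apply: eq_bigr => i _; rewrite inner_ractl inner_frame.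
  by rewrite mulr_sumr; apply: eq_bigr => j _; rewrite mulrA.
have sX i j : X j i = star (c j) * star (g i j) * c i.
  by rewrite /X /g (inner_star (f i) (f j)).
have qE : q x = \sum_i star (c i) * c i.
  by apply: eq_bigr => i _; rewrite /c inner_star.
pose Q := \sum_i \sum_j sc (rnorm (g i j)) * (star (c i) * c i).
have pQ : psd (Q - << K x, K x >>).
  have -> : Q - << K x, K x >> = sc 2^-1 * ((Q - << K x, K x >>) + (Q - << K x, K x >>)).
    by rewrite sc_half.
  apply: psdZ; first by rewrite invr_ge0.
  have -> : Q - << K x, K x >> + (Q - << K x, K x >>) = \sum_i \sum_j
      (sc (rnorm (g i j)) * (star (c i) * c i + star (c j) * c j) - (X i j + X j i)).
    have Q' : Q = \sum_i \sum_j sc (rnorm (g i j)) * (star (c j) * c j).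
      rewrite /Q exchange_big /=; apply: eq_bigr => i _; apply: eq_bigr => j _.
      by rewrite /g rnorm_innerC.
    have KK' : << K x, K x >> = \sum_i \sum_j X j i by rewrite KK exchange_big.
    rewrite {2}Q' {2}KK' KK /Q addrACA -opprD -!big_split /= -sumrB.
    apply: eq_bigr => i _; rewrite -!big_split /= -sumrB; apply: eq_bigr => j _.
    by rewrite mulrDr.
  apply: psd_sum => i _; apply: psd_sum => j _; rewrite (sX i j) /X; exact: psd_cross.
have -> : sc B * q x - << K x, K x >> =
    (sc B * q x - Q) + (Q - << K x, K x >>) by rewrite addrA subrK.
apply: psdD => //; rewrite qE mulr_sumr -sumrB; apply: psd_sum => i _.
rewrite -mulr_suml -mulrBl.
have -> : \sum_(j < n) sc (rnorm (g i j)) = sc (\sum_(j < n) rnorm (g i j)) :> A.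
  by elim/big_ind2: _ => [|s u t v -> ->|//]; rewrite ?sc0 ?scD.
by rewrite -scB; apply: psdZ; [rewrite subr_ge0; exact: hB | exact: psd_starM].
Qed.

Lemma inner_frame_diag x : << x, K x >> = q x.
Proof. exact: inner_frame. Qed.

Lemma inner_framel_diag x : << K x, x >> = q x.
Proof. by rewrite inner_framel inner_frame. Qed.

(** The frame operator [K] is at most [B], because [K^2 <= B K]. *)
Lemma qframe_le (B : R) : 0 < B ->
  (forall i : 'I_n, \sum_(j < n) rnorm << f i, f j >> <= B) ->
  forall x, psd (sc B * << x, x >> - q x).
Proof.
move=> B0 hB x; pose y := x - (B^-1)%:C%C *: K x.
have BB : sc B * sc B^-1 = 1 :> A by rewrite -scM divff ?sc1// gt_eqF.
have -> : sc B * << x, x >> - q x =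
    sc B * << y, y >> + sc B^-1 * (sc B * q x - << K x, K x >>).
  rewrite /y !innerBl !innerBr !innerZl !innerZr inner_frame_diag inner_framel_diag.
  rewrite !mulrBr !mulrA (sc_comm B^-1 (sc B)) BB !mul1r.
  by ncring.
apply: psdD; first by apply: psdZ; [exact: ltW | exact: psd_inner].
by apply: psdZ; [rewrite invr_ge0 ltW | exact: frame_schur].
Qed.

End Frame.
End HilbertModule.

(** * Vectors almost orthogonal to finitely many others *)

Section Selection.
Context {R : realType} {A : cstarAlgType R} {M : hilbertModType A}.
Implicit Types (x y z u v w : M) (a b c d : A) (s t : R).

Local Notation "<< x , y >>" := (@inner R A M x y).
Local Notation "x ** a" := (@ract R A M x a) (at level 40).

Lemma rnorm_inner_le x y : rnorm << x, y >> <= rnorm x * rnorm y.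
Proof.
have [x0|xn0] := eqVneq (rnorm x) 0.
  by rewrite (rnorm0_eq0 x0) inner0l [X in X <= _]rnorm0; apply: mulr_ge0;
    exact: rnorm_ge0.
have x0 : 0 < rnorm x by rewrite lt_def xn0 rnorm_ge0.
rewrite -(ler_pXn2r (n := 2)) ?nnegrE ?mulr_ge0 ?rnorm_ge0// exprMn.
apply: le_trans (rnorm_qframe_term (fun=> x) y (ltnSn 0)) _.
have B0 : 0 < rnorm x ^+ 2 by rewrite exprn_gt0.
have := @qframe_le _ _ _ (fun=> x) 1 _ B0.
rewrite -rnorm_inner => /(_ _ y) h.
apply: le_trans (psd_norm_le (psd_qframe _ _ _) (h _)) _.
  by move=> i; rewrite big_ord1.
by rewrite rnorm_scM ger0_norm ?rnorm_ge0// [rnorm << y, y >>]rnorm_inner.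
Qed.

(** Powers of [L = 1 - K], for a frame operator [K] with [0 <= K <= 1]. *)
Section Contraction.
Variables (f : nat -> M) (n : nat).
Hypothesis f1 : forall i : 'I_n, \sum_(j < n) rnorm << f i, f j >> <= 1.
Local Notation K := (frame f n).
Local Notation q := (qframe f n).

Let L x := x - K x.

Let qK x : psd (q x - << K x, K x >>).
Proof. by have := frame_schur f1 x; rewrite sc1 mul1r. Qed.

Let LL x : << L x, L x >> = << x, x >> - q x - q x + << K x, K x >>.
Proof.
rewrite /L !innerBl !innerBr inner_frame_diag inner_framel_diag.
by ncring.
Qed.

Lemma frame_compl_contract x : psd (<< x, x >> - << L x, L x >>).
Proof.
have -> : << x, x >> - << L x, L x >> = q x + (q x - << K x, K x >>).
  by rewrite LL; ncring.
by apply: psdD => //; exact: psd_qframe.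
Qed.

Lemma frame_compl_iter_contract m x :
  psd (<< x, x >> - << iter m L x, iter m L x >>).
Proof.
elim: m => [|m IH]; first by rewrite subrr; exact: psd0.
have := psdD IH (frame_compl_contract (iter m L x)).
by rewrite addrA subrK.
Qed.

Lemma rnorm_frame_compl_iter m x : rnorm (iter m L x) <= rnorm x.
Proof.
rewrite -(ler_pXn2r (n := 2)) ?nnegrE ?rnorm_ge0// -!rnorm_inner.
by apply: psd_norm_le; [exact: psd_inner | exact: frame_compl_iter_contract].
Qed.

Lemma frame_compl_adj m x y : << x, iter m L y >> = << iter m L x, y >>.
Proof.
elim: m x => [//|m IH] x; rewrite iterSr /= -[in RHS]iterS iterSr -IH.
by rewrite -iterSr /= {1}/L innerBr -inner_framel -innerBl.
Qed.

Let q1 x : psd (<< x, x >> - q x).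
Proof. by have := qframe_le ltr01 f1 x; rewrite sc1 mul1r. Qed.

(** [K - L K L = K^2 + (K^2 - K^3)]. *)
Let q_decr x : psd (q x - q (L x)).
Proof.
have -> : q x - q (L x) = << K x, K x >> + (<< K x, K x >> - q (K x)).
  rewrite -[q (L x)]inner_frame_diag /L frameB innerBl !innerBr.
  rewrite inner_frame_diag -(inner_framel f n x (K x)) inner_frame_diag.
  by ncring.
by apply: psdD => //; exact: psd_inner.
Qed.

(** Operator form of [(1 - t)^(2 m) + m t (1 - t)^(2 m) <= 1] on the unit
    interval. *)
Lemma qframe_compl_iter m x :
  psd (<< x, x >> - << iter m L x, iter m L x >> - sc m%:R * q (iter m L x)).
Proof.
elim: m => [|m IH]; first by rewrite sc0 mul0r subr0 subrr; exact: psd0.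
set y := iter m L x in IH; rewrite iterS -/y.
have h1 : psd (<< y, y >> - << L y, L y >> - q y).
  by rewrite (_ : _ - q y = q y - << K y, K y >>)// LL; ncring.
have h2 : psd (sc m.+1%:R * (q y - q (L y))) by apply: psdZ.
have := psdD IH (psdD h1 h2).
rewrite (_ : << x, x >> - << L y, L y >> - sc m.+1%:R * q (L y) =
  << x, x >> - << y, y >> - sc m%:R * q y +
  (<< y, y >> - << L y, L y >> - q y + sc m.+1%:R * (q y - q (L y))))//.
by rewrite -natr1 scD sc1; ncring.
Qed.

Lemma rnorm_inner_compl_iter m x i : (i < n)%N ->
  m%:R * rnorm << f i, iter m L x >> ^+ 2 <= rnorm x ^+ 2.
Proof.
move=> ilt; rewrite -[rnorm x ^+ 2]rnorm_inner.
apply: le_trans (ler_wpM2l (ler0n _ _) (rnorm_qframe_term f _ ilt)) _.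
rewrite -[m%:R](@ger0_norm R)// -rnorm_scM; apply: psd_norm_le.
  by apply: psdZ => //; exact: psd_qframe.
set y := iter m L x; rewrite (_ : _ - _ = << y, y >> +
  (<< x, x >> - << y, y >> - sc m%:R * q y)); last by ncring.
by apply: psdD; [exact: psd_inner | exact: qframe_compl_iter].
Qed.

Lemma frame_compl_span m x : exists a : nat -> A,
  (forall i, (i < n)%N -> rnorm (a i) <= m%:R * rnorm x) /\
  x - iter m L x = \sum_(i < n) f i ** a i.
Proof.
have ract0r y : y ** 0 = 0.
  by apply: (addrI (y ** 0)); rewrite -ractDr !addr0.
elim: m => [|m [a [ale aE]]].
  exists (fun=> 0); split=> [i _|]; first by rewrite rnorm0 mul0r.
  by rewrite subrr big1.
exists (fun i => a i + << f i, iter m L x >>); split=> [i ilt|].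
  apply: le_trans (rnormD _ _) _; rewrite -natr1 mulrDl mul1r lerD ?ale//.
  apply: le_trans (rnorm_inner_le _ _) _; rewrite -[leRHS]mul1r.
  apply: ler_pM; rewrite ?rnorm_ge0 ?rnorm_frame_compl_iter//.
  rewrite -(ler_pXn2r (n := 2)) ?nnegrE ?rnorm_ge0// expr1n -rnorm_inner.
  apply: le_trans (f1 (Ordinal ilt)); rewrite (bigD1 (Ordinal ilt))//= lerDl.
  by apply: sumr_ge0 => j _; exact: rnorm_ge0.
under eq_bigr do rewrite ractDr.
rewrite big_split /= -aE -/(frame f n _) /L opprB addrA.
by rewrite addrAC.
Qed.

End Contraction.

(** [E] lies within [r] of a finitely generated piece of [M]. *)
Definition approximable (r : R) (E : set M) : Prop :=
  exists (n : nat) (f : nat -> M) (C : R), forall x, E x ->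
    exists a : nat -> A, (forall i, (i < n)%N -> rnorm (a i) <= C) /\
      rnorm (x - \sum_(i < n) f i ** a i) <= r.

(** With [L = 1 - t^2 K], [K] the frame operator of [f], take [y = L^(2 m) x]
   of norm [> r] and [w = y / rnorm y]: then [x - y] is in the span of [f],
   [<f_i, w>] is small for large [m], and [<x, y> >= <y, y>]. *)
Lemma select_orthogonal (E : set M) (Bd r delta : R) (f : nat -> M) n :
  (forall x, E x -> rnorm x <= Bd) -> 0 < r -> ~ approximable r E -> 0 < delta ->
  exists x w (phi : {scalar A}), [/\ E x, rnorm w <= 1,
    forall i, (i < n)%N -> rnorm << f i, w >> <= delta,
    state phi & r <= complex.Re (phi << x, w >>)].
Proof.
move=> EB r0 nE d0.
pose S := \sum_(i < n) \sum_(j < n) rnorm << f i, f j >>.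
have S0 : 0 <= S by do 2!(apply: sumr_ge0 => ? _); exact: rnorm_ge0.
pose t := (S + 1)^-1.
have S1 : 0 < S + 1 by rewrite ltr_wpDl.
have t0 : 0 < t by rewrite invr_gt0.
have t1 : t <= 1 by rewrite invf_le1// lerDr.
pose g i := t%:C%C *: f i.
have g1 (i : 'I_n) : \sum_(j < n) rnorm << g i, g j >> <= 1.
  have -> : \sum_(j < n) rnorm << g i, g j >> = t * (t * \sum_(j < n) rnorm << f i, f j >>).
    rewrite !mulr_sumr; apply: eq_bigr => j _.
    by rewrite innerZl innerZr !rnorm_scM ger0_norm// ltW.
  have Sj0 : 0 <= \sum_(j < n) rnorm << f i, f j >>.
    by apply: sumr_ge0 => j _; exact: rnorm_ge0.
  have iS : \sum_(j < n) rnorm << f i, f j >> <= S.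
    rewrite /S [leRHS](bigD1 i)//= lerDl; apply: sumr_ge0 => k _.
    by apply: sumr_ge0 => j _; exact: rnorm_ge0.
  have tS : t * \sum_(j < n) rnorm << f i, f j >> <= 1.
    by rewrite ler_pdivrMl// mulr1; lra.
  by rewrite mulr_ile1// ?mulr_ge0// ltW.
pose B := `|Bd| + 1; have B0 : 0 < B by rewrite ltr_wpDl.
(* the inner products of [w] with the [f_i] have squares at most
   [B^2 / (m t^2 r^2)] *)
pose e := (t * r * delta) ^+ 2.
have e0 : 0 < e by rewrite exprn_gt0// !mulr_gt0.
pose m := (Num.truncn (B ^+ 2 / e)).+1.
have mB : B ^+ 2 <= m%:R * e.
  by rewrite -ler_pdivrMr// ltW// /m truncnS_gt.
pose N := (m + m)%N; pose L x := x - frame g n x.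
have [x Ex xr] : exists2 x, E x & r < rnorm (iter N L x).
  apply: contrapT => no; apply: nE; exists n, f, (N%:R * B) => x Ex.
  have [a [ale aE]] := frame_compl_span g1 N x.
  exists (fun i => sc t * a i); split=> [i ilt|].
    rewrite rnorm_scM gtr0_norm//; apply: le_trans (ler_piMl _ t1) _.
      exact: rnorm_ge0.
    apply: le_trans (ale _ ilt) _; rewrite ler_wpM2l//.
    by rewrite (le_trans (EB _ Ex))// /B; have := ler_norm Bd; lra.
  have -> : \sum_(i < n) f i ** (sc t * a i) = \sum_(i < n) g i ** a i.
    by apply: eq_bigr => i _; rewrite ractM ract_sc.
  rewrite -aE subKr leNgt; apply/negP => h; apply: no.
  by exists x.
set y := iter N L x in xr.
have y0 : 0 < rnorm y by exact: lt_trans xr.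
have [phi [sphi phiy]] := exists_state (psd_inner y).
have yy : psd (<< x, y >> - << y, y >>).
  rewrite /y /N iterD frame_compl_adj//.
  exact: frame_compl_iter_contract.
exists x, ((rnorm y)^-1%:C%C *: y), phi; split => //.
- by rewrite rnormZr gtr0_norm ?invr_gt0// mulVf// gt_eqF.
- move=> i ilt; rewrite innerZr rnorm_scM gtr0_norm ?invr_gt0// ler_pdivrMl//.
  have := rnorm_inner_compl_iter g1 N x ilt; rewrite -/L -/y.
  rewrite innerZl rnorm_scM gtr0_norm// => h.
  have xB : rnorm x ^+ 2 <= B ^+ 2.
    rewrite lerXn2r ?nnegrE ?rnorm_ge0// ?ltW//.
    by rewrite (le_lt_trans (EB _ Ex))// /B; have := ler_norm Bd; lra.
  have Nm : m%:R <= N%:R :> R by rewrite ler_nat leq_addr.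
  have h2 : N%:R * (t * rnorm << f i, y >>) ^+ 2 <= N%:R * e.
    apply: le_trans h _; apply: le_trans xB _; apply: le_trans mB _.
    by rewrite ler_wpM2r// ltW.
  have N0 : 0 < N%:R :> R by rewrite ltr0n.
  have {h2}h2 : t * rnorm << f i, y >> <= t * r * delta.
    rewrite -(ler_pXn2r (n := 2)) ?nnegrE//.
    - by move: h2; rewrite ler_pM2l.
    - by apply: mulr_ge0; [exact: ltW | exact: rnorm_ge0].
    - by rewrite ltW// !mulr_gt0.
  have {}h2 : rnorm << f i, y >> <= r * delta by move: h2; rewrite -mulrA ler_pM2l.
  by apply: le_trans h2 _; rewrite ler_pM2r// ltW.
- rewrite innerZr scE linearZ /=.
  have := state_Re_le sphi yy; rewrite rnorm_inner in phiy.
  case: (phi << x, y >>) (phi << y, y >>) phiy => [p p'] [p2 p2'] /= h1 h2.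
  rewrite mul0r subr0 ler_pdivlMl//.
  apply: le_trans h2; apply: le_trans h1; rewrite expr2 ler_pM2l//.
  exact: ltW.
Qed.

End Selection.

(** * Admissible systems *)

Section Admissible.
Context {R : realType} {A : cstarAlgType R} {M : hilbertModType A}.
Implicit Types (x y z u v w : M) (a b c d : A) (s t : R) (X : nat -> M).

Local Notation "<< x , y >>" := (@inner R A M x y).
Local Notation "x ** a" := (@ract R A M x a) (at level 40).

Lemma bracket_seriesE X x n : bracket_series X x n = qframe X n x.
Proof. by rewrite /bracket_series /series /= big_mkord. Qed.

Lemma bracket_series_tail X x m k :
  bracket_series X x (m + k) - bracket_series X x m =
  qframe (fun i => X (m + i)%N) k x.
Proof.
rewrite /bracket_series /series /= (big_cat_nat (n := m)) ?leq_addr//=.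
rewrite [X in X - _]addrC addrK -{1}[m]add0n big_addn addKn big_mkord.
by apply: eq_bigr => i _; rewrite addnC.
Qed.

Lemma qframeD_le X n x y :
  psd (sc 2 * qframe X n x + sc 2 * qframe X n y - qframe X n (x + y)).
Proof.
have two a : sc 2 * a = a + a by rewrite (_ : 2 = 1 + 1 :> R)// scD sc1 mulrDl mul1r.
rewrite (_ : _ - _ = qframe X n (x - y)); first exact: psd_qframe.
rewrite !two /qframe -!big_split /= -sumrB; apply: eq_bigr => i _.
by rewrite !innerDl !innerDr !innerNl !innerNr; ncring.
Qed.

Lemma rnorm_qframeD X n x y :
  rnorm (qframe X n (x + y)) <= 2 * rnorm (qframe X n x) + 2 * rnorm (qframe X n y).
Proof.
apply: le_trans (psd_norm_le (psd_qframe _ _ _) (qframeD_le X n x y)) _.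
by apply: le_trans (rnormD _ _) _; rewrite !rnorm_scM ger0_norm.
Qed.

Lemma rnorm_qframe_ract X n x a :
  rnorm (qframe X n (x ** a)) <= rnorm a ^+ 2 * rnorm (qframe X n x).
Proof.
have -> : qframe X n (x ** a) = star a * qframe X n x * a.
  rewrite /qframe mulr_sumr mulr_suml; apply: eq_bigr => i _.
  by rewrite inner_ract inner_ractl !mulrA.
apply: le_trans (rnormM _ _) _.
apply: le_trans (ler_wpM2r (rnorm_ge0 _) (rnormM _ _)) _.
by rewrite rnorm_star mulrAC -expr2.
Qed.

(** A sufficient condition, by Schur's test, for the Gram matrix of [X] to be a
    contraction. *)
Definition gram_le1 X := forall n (i : 'I_n), \sum_(j < n) rnorm << X i, X j >> <= 1.

(** Under [gram_le1 X], convergence of the bracket series propagates to the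
    closed submodule generated by the elements at which it is known. *)
Section GramLe1.
Variable X : nat -> M.
Hypothesis X1 : gram_le1 X.

Lemma gram_le1_shift m : gram_le1 (fun i => X (m + i)%N).
Proof.
move=> n i; apply: le_trans (X1 (rshift m i)) => /=.
rewrite big_split_ord /= lerDr; apply: sumr_ge0 => j _; exact: rnorm_ge0.
Qed.

Lemma gram_le1_qframe n x : psd (<< x, x >> - qframe X n x).
Proof. by have := qframe_le ltr01 (X1 (n := n)) x; rewrite sc1 mul1r. Qed.

Lemma gram_le1_norm i : rnorm (X i) <= 1.
Proof.
rewrite -(ler_pXn2r (n := 2)) ?nnegrE ?rnorm_ge0// expr1n -rnorm_inner.
apply: le_trans (X1 (ord_max : 'I_i.+1)); rewrite (bigD1 ord_max)//= lerDl.
by apply: sumr_ge0 => j _; exact: rnorm_ge0.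
Qed.

(** The partial sums of the bracket series at [x] form a Cauchy sequence. *)
Definition tail_small x := forall e : R, 0 < e -> exists m, forall m' k,
  (m <= m')%N -> rnorm (qframe (fun i => X (m' + i)%N) k x) <= e.

Lemma tail_small0 : tail_small 0.
Proof.
move=> e e0; exists 0%N => m' k _; rewrite /qframe big1 ?rnorm0 ?ltW// => i _.
by rewrite inner0l mul0r.
Qed.

Lemma tail_smallD x y : tail_small x -> tail_small y -> tail_small (x + y).
Proof.
move=> tx ty e e0; have e4 : 0 < e / 4 by rewrite divr_gt0.
have [m Hm] := tx _ e4; have [p Hp] := ty _ e4; exists (maxn m p) => m' k.
rewrite geq_max => /andP[/(Hm _ k) hm /(Hp _ k) hp].
apply: le_trans (rnorm_qframeD _ _ _ _) _; lra.
Qed.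

Lemma tail_small_ract x a : tail_small x -> tail_small (x ** a).
Proof.
move=> tx e e0; have a0 : 0 < rnorm a ^+ 2 + 1 by rewrite ltr_wpDl// sqr_ge0.
have [m Hm] := tx _ (divr_gt0 e0 a0); exists m => m' k /(Hm _ k).
rewrite ler_pdivlMr// => h; apply: le_trans (rnorm_qframe_ract _ _ _ _) _.
by apply: le_trans h; rewrite mulrC ler_wpM2l ?rnorm_ge0// lerDl.
Qed.

Lemma tail_small_closure x :
  (forall e, 0 < e -> exists2 y, tail_small y & rnorm (x - y) <= e) ->
  tail_small x.
Proof.
move=> xe e e0; have e4 : 0 < e / 4 by rewrite divr_gt0.
have s0 : 0 < Num.sqrt (e / 4) by rewrite sqrtr_gt0.
have [y ty yx] := xe _ s0; have [m Hm] := ty _ e4; exists m => m' k mm.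
rewrite -(subrK y x); apply: le_trans (rnorm_qframeD _ _ _ _) _.
have h : rnorm (qframe (fun i => X (m' + i)%N) k (x - y)) <= e / 4.
  rewrite -(sqr_sqrtr (ltW e4)); apply: (@le_trans _ _ (rnorm (x - y) ^+ 2)).
    rewrite -rnorm_inner; apply: psd_norm_le; first exact: psd_qframe.
    have := qframe_le ltr01 (@gram_le1_shift m' k) (x - y).
    by rewrite sc1 mul1r.
  by rewrite lerXn2r ?nnegrE ?rnorm_ge0// ltW.
by have := Hm _ k mm; lra.
Qed.

Lemma tail_small_admissible : (forall x, tail_small x) -> admissible X.
Proof.
move=> tX; split; last exact: gram_le1_norm.
move=> x; have [l ul] : exists l, rcvg (bracket_series X x) l.
  apply: rcauchy_cvg => e e0; have e4 : 0 < e / 4 by rewrite divr_gt0.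
  have [N HN] := tX x _ e4; exists N => m n Nm Nn.
  apply: le_lt_trans (rnorm_triangle (bracket_series X x N) _ _) _.
  rewrite [X in _ + X]rnormBC.
  have := HN _ (m - N)%N (leqnn N); have := HN _ (n - N)%N (leqnn N).
  by rewrite -!bracket_series_tail !subnKC//; lra.
have /rcvgP cl := ul; have -> : limn (bracket_series X x) = l by exact: cvg_lim.
split; first exact: cl.
apply: psd_cpos; apply: (psd_closed (u := fun n => << x, x >> - bracket_series X x n)).
  by move=> n; rewrite bracket_seriesE; exact: gram_le1_qframe.
apply: (rcvg_lip (f := fun b => << x, x >> - b) (C := 1)) (ul) => n.
rewrite mul1r (_ : _ - _ = l - bracket_series X x n); last by ncring.
by rewrite rnormBC.
Qed.

End GramLe1.

Lemma exp_half_small (e : R) : 0 < e ->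
  exists m, forall m', (m <= m')%N -> 2^-1 ^+ m' <= e.
Proof.
move=> e0; exists (Num.truncn e^-1).+1 => m' mm.
have h : e^-1 < m'%:R.
  apply: lt_le_trans (truncnS_gt _) _; rewrite ?ler_nat//.
rewrite exprVn -[e]invrK lef_pV2 ?posrE ?exprn_gt0 ?invr_gt0//.
by rewrite (le_trans (ltW h))// -natrX ler_nat ltnW// ltn_expl.
Qed.

Lemma sum_half_le m n : \sum_(i < n) (2^-1 : R) ^+ (m + i).+1 <= 2^-1 ^+ m.
Proof.
suff -> : \sum_(i < n) (2^-1 : R) ^+ (m + i).+1 = 2^-1 ^+ m - 2^-1 ^+ (m + n).
  by rewrite gerBl exprn_ge0.
elim: n => [|n IH]; first by rewrite big_ord0 addn0 subrr.
by rewrite big_ord_recr /= IH addnS exprS; field.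
Qed.

(** If [E] is not within [r] of any finitely generated piece of [M], some
    admissible system and states detect, at each index, an element of [E] of
    size almost [r]. *)
Lemma exists_detecting_system (E : set M) (Bd r delta : R) :
  countably_generated M ->
  (forall x, E x -> rnorm x <= Bd) -> 0 < r -> ~ approximable r E -> 0 < delta ->
  exists X (Phi : nat -> {scalar A}), [/\ admissible X, forall k, state (Phi k) &
    forall k, exists2 x, E x &
      r / Num.sqrt (1 + delta) <= complex.Re (Phi k << x, X k >>)].
Proof.
move=> [g gdense] EB r0 nE d0; pose d n := delta * 2^-1 ^+ n.+1.
have dp n : 0 < d n by rewrite mulr_gt0// exprn_gt0// invr_gt0.
pose good (p : seq M * nat) (z : M * M * {scalar A}) :=
  [/\ E z.1.1, rnorm z.1.2 <= 1,
      forall v, v \in p.1 -> rnorm << v, z.1.2 >> <= d p.2,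
      state z.2 & r <= complex.Re (z.2 << z.1.1, z.1.2 >>)].
have [step Hstep] : {step & forall p, good p (step p)}.
  apply: choice => -[F n].
  have [x [w [phi [Ex w1 fw sphi rphi]]]] :=
    select_orthogonal (nth 0 F) (size F) EB r0 nE (dp n).
  exists (x, w, phi); split => //= v /(nthP 0)[i ilt <-]; exact: fw.
pose fix ws n : seq M := if n is m.+1 then
  (step (ws m ++ mkseq g m.+1, m)).1.2 :: ws m else [::].
pose z n := step (ws n ++ mkseq g n.+1, n).
pose w n := (z n).1.2.
have w_ws i n : (i < n)%N -> w i \in ws n.
  elim: n => // n IH; rewrite ltnS leq_eqVlt => /predU1P[->|/IH h].
    exact: mem_head.
  by rewrite inE h orbT.
have w1 n : rnorm (w n) <= 1 by have [] := Hstep (ws n ++ mkseq g n.+1, n).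
have ww i n : (i < n)%N -> rnorm << w i, w n >> <= d n.
  move=> /w_ws h; have [_ _ + _ _] := Hstep (ws n ++ mkseq g n.+1, n).
  by apply; rewrite mem_cat h.
have gw i n : (i <= n)%N -> rnorm << g i, w n >> <= d n.
  move=> h; have [_ _ + _ _] := Hstep (ws n ++ mkseq g n.+1, n).
  apply; rewrite mem_cat orbC; apply/orP; left.
  by apply/mapP; exists i => //; rewrite mem_iota.
have d_decr i j : (i <= j)%N -> d j <= d i.
  by move=> ij; rewrite ler_pM2l// ler_wiXn2l ?invr_ge0// invf_le1// ler1n.
have wwd i j : i != j -> rnorm << w i, w j >> <= d j.
  rewrite neq_ltn => /orP[/ww//|ji]; rewrite rnorm_innerC.
  by apply: le_trans (ww _ _ ji) _; apply: d_decr; exact: ltnW.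
have sumd n : \sum_(j < n) d j <= delta.
  rewrite -mulr_sumr -[leRHS]mulr1 ler_pM2l//.
  by have := sum_half_le 0 n; rewrite expr0.
have D0 : 0 < 1 + delta by rewrite addr_gt0.
pose k := (Num.sqrt (1 + delta))^-1.
have k0 : 0 < k by rewrite invr_gt0 sqrtr_gt0.
have kk : k * k * (1 + delta) = 1.
  by rewrite -expr2 exprVn sqr_sqrtr ?ltW// mulVf// gt_eqF.
have k1 : k <= 1 by nra.
(* rescaling compensates the off-diagonal part, of row sums at most [delta], of
   the Gram matrix of [w] *)
pose X n := k%:C%C *: w n.
have X1 : gram_le1 X.
  move=> n i; rewrite -[leRHS]kk.
  have -> : \sum_(j < n) rnorm << X i, X j >> = k * k * \sum_(j < n) rnorm << w i, w j >>.
    rewrite mulr_sumr; apply: eq_bigr => j _.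
    by rewrite innerZl innerZr !rnorm_scM ger0_norm ?mulrA// ltW.
  rewrite ler_pM2l ?mulr_gt0// (bigD1 i)//=; apply: lerD.
    by rewrite rnorm_inner expr_le1 ?rnorm_ge0.
  apply: le_trans (sumd n); rewrite [leRHS](bigD1 i)//=.
  apply: ler_wpDl; first exact: ltW.
  by apply: ler_sum => j ji; apply: wwd; rewrite eq_sym.
have Xg (a i : nat) : (a <= i)%N -> rnorm << X i, g a >> <= d i.
  move=> ai; rewrite innerZl rnorm_scM gtr0_norm// rnorm_innerC.
  apply: le_trans (gw _ _ ai); rewrite ler_piMl ?rnorm_ge0//.
have tg (a : nat) : tail_small X (g a).
  move=> e e0; have [m Hm] := exp_half_small (divr_gt0 e0 (mulr_gt0 d0 d0)).
  exists (maxn a m) => m' n; rewrite geq_max => /andP[am mm].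
  apply: le_trans (rnorm_sum _ _ _) _.
  apply: (@le_trans _ _ (\sum_(i < n) delta * (delta * 2^-1 ^+ (m' + i).+1))).
    apply: ler_sum => i _; rewrite -inner_star rnorm_starM.
    have h := Xg a (m' + i)%N (leq_trans am (leq_addr _ _)).
    apply: (@le_trans _ _ (d (m' + i)%N ^+ 2)).
      by rewrite lerXn2r ?nnegrE ?rnorm_ge0// ltW.
    rewrite expr2; apply: ler_wpM2r; first exact: ltW.
    by rewrite -[leRHS]mulr1 ler_pM2l// exprn_ile1 ?invr_ge0// invf_le1// ler1n.
  rewrite -!mulr_sumr mulrA -ler_pdivlMl ?mulr_gt0//.
  by apply: le_trans (sum_half_le _ _) _; rewrite mulrC; exact: Hm.
have tX x : tail_small X x.
  apply: tail_small_closure => // e e0.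
  have : closure [set x | exists (n : nat) (a : nat -> A),
      x = \sum_(i < n) g i ** a i] x by rewrite gdense.
  have eC : 0 < e%:C%C :> R[i] by rewrite ltcR.
  move=> /(_ _ (nbhsx_ballx x _ eC))[y [[n [a ->]]]].
  rewrite -ball_normE /= normE_rnorm ltcR => xy.
  exists (\sum_(i < n) g i ** a i); last exact: ltW.
  elim/big_ind: _ => [|u v|i _]; first exact: tail_small0.
    exact: tail_smallD.
  exact: tail_small_ract.
exists X, (fun n => (z n).2); split.
- exact: tail_small_admissible.
- by move=> n; have [] := Hstep (ws n ++ mkseq g n.+1, n).
move=> n; have [Ex _ _ _ rphi] := Hstep (ws n ++ mkseq g n.+1, n).
exists (z n).1.1 => //; rewrite innerZr scE linearZ /= -/(z n) -/(w n).
move: rphi; rewrite -/(z n) -/(w n); case: ((z n).2 _) => p p' /= h.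
by rewrite mul0r subr0 mulrC ler_pM2l.
Qed.

End Admissible.

(** * The seminorms: total boundedness and lower bounds *)

Section FiniteGrid.
Context {R : realType}.
Implicit Types (s t : R).

Lemma finite_representatives (T : Type) (J : finType) (g : T -> J) (P : T -> Prop) (x0 : T) :
  exists rep : J -> T, forall x, P x -> P (rep (g x)) /\ g (rep (g x)) = g x.
Proof.
pose good j y := (exists x, P x /\ g x = j) -> P y /\ g y = j.
have [rep Hrep] : {rep : J -> T & forall j, good j (rep j)}.
  apply: choice => j; have [[x [Px gx]]|no] := pselect (exists x, P x /\ g x = j).
    by exists x.
  by exists x0.
by exists rep => x Px; apply: Hrep; exists x.
Qed.

Lemma truncn_eq_dist (s t : R) : 0 <= s -> 0 <= t ->
  Num.truncn s = Num.truncn t -> `|s - t| < 1.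
Proof.
move=> s0 t0 st; have /andP[h1 h2] := truncn_itv s0.
have /andP[h3 h4] := truncn_itv t0; rewrite st in h1 h2.
move: h2 h4; rewrite -natr1 ltr_norml => h2 h4; apply/andP; split; lra.
Qed.

Lemma normc_nonneg (c : R[i]) : 0 <= Normc.normc c.
Proof. by case: c => u v; exact: sqrtr_ge0. Qed.

Lemma normc_sq (c : R[i]) :
  Normc.normc c ^+ 2 = complex.Re c ^+ 2 + complex.Im c ^+ 2.
Proof. by case: c => u v /=; rewrite sqr_sqrtr// addr_ge0 ?sqr_ge0. Qed.

Lemma normr_Re_le (c : R[i]) : `|complex.Re c| <= Normc.normc c.
Proof.
rewrite -(ler_pXn2r (n := 2)) ?nnegrE ?normc_nonneg ?normr_ge0//.
by rewrite normc_sq real_normK ?num_real// lerDl sqr_ge0.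
Qed.

Lemma normr_Im_le (c : R[i]) : `|complex.Im c| <= Normc.normc c.
Proof.
rewrite -(ler_pXn2r (n := 2)) ?nnegrE ?normc_nonneg ?normr_ge0//.
by rewrite normc_sq real_normK ?num_real// lerDr sqr_ge0.
Qed.

(** The index of the cell of [s], of width [e], in a subdivision of [-D, D]. *)
Definition grid_cell (D e : R) (s : R) : 'I_(Num.truncn (2 * D / e)).+1 :=
  inord (Num.truncn ((s + D) / e)).

Lemma grid_cell_dist (D e s t : R) : 0 < e -> `|s| <= D -> `|t| <= D ->
  grid_cell D e s = grid_cell D e t -> `|s - t| < e.
Proof.
move=> e0 sD tD /(congr1 (@nat_of_ord _)).
have cellE r : `|r| <= D -> nat_of_ord (grid_cell D e r) = Num.truncn ((r + D) / e).
  rewrite ler_norml => /andP[r1 r2]; rewrite inordK// ltnS.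
  by apply: le_truncn; rewrite ler_pM2r ?invr_gt0//; lra.
have ge0 r : `|r| <= D -> 0 <= (r + D) / e.
  by rewrite ler_norml => /andP[r1 r2]; apply: divr_ge0; [lra | exact: ltW].
rewrite !cellE// => /(truncn_eq_dist (ge0 _ sD) (ge0 _ tD)).
rewrite -mulrBl opprD addrACA subrr addr0 normrM normfV (gtr0_norm e0).
by rewrite ltr_pdivrMr// mul1r.
Qed.

End FiniteGrid.

Section Seminorm.
Context {R : realType} {A : cstarAlgType R} {M : hilbertModType A}.
Implicit Types (x y z u v w : M) (a b c d : A) (s t : R) (X : nat -> M).
Implicit Types (Phi : nat -> {scalar A}).

Local Notation "<< x , y >>" := (@inner R A M x y).
Local Notation "x ** a" := (@ract R A M x a) (at level 40).

Lemma pXPhi_leP X Phi x (r : R) : 0 <= r ->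
  (pXPhi X Phi x <= r%:E)%E <->
  (forall k n, \sum_(k <= i < n) Normc.normc (Phi k << x, X i >>) ^+ 2 <= r ^+ 2).
Proof.
move=> r0; have sqE : r%:E = sqrte ((r ^+ 2)%:E).
  by rewrite /= sqrtr_sqr ger0_norm.
have sum0 k n : (k <= n)%N -> predT n ->
    (0 <= ((Normc.normc (Phi k << x, X n >>)) ^+ 2)%:E)%E.
  by move=> _ _; rewrite lee_fin sqr_ge0.
rewrite sqE /pXPhi lee_sqrt ?lee_fin ?sqr_ge0//; split=> [h k n|h].
  rewrite -lee_fin -sumEFin; apply: le_trans (nneseries_lim_ge n (sum0 k)) _.
  by apply: le_trans h; apply: ereal_sup_ubound; exists k.
apply: ge_ereal_sup => _ [k _ <-].
apply: lime_le; first exact: (is_cvg_nneseries (sum0 k)).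
by near=> n; rewrite sumEFin lee_fin.
Unshelve. all: by end_near.
Qed.

(** Minkowski's inequality. The weights in
    [(a + b)^2 <= (1 + s / r) a^2 + (1 + r / s) b^2] are those for which the
    bounds [r^2] and [s^2] combine to [(r + s)^2]. *)
Lemma pXPhi_add X Phi x y (r s : R) : 0 < r -> 0 < s ->
  (pXPhi X Phi x <= r%:E)%E -> (pXPhi X Phi y <= s%:E)%E ->
  (pXPhi X Phi (x + y)%R <= (r + s)%:E)%E.
Proof.
move=> r0 s0 /(pXPhi_leP _ _ _ (ltW r0)) hx /(pXPhi_leP _ _ _ (ltW s0)) hy.
apply/pXPhi_leP; first by rewrite addr_ge0// ltW.
move=> k n.
apply: (@le_trans _ _ (\sum_(k <= i < n)
    ((1 + s / r) * Normc.normc (Phi k << x, X i >>) ^+ 2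
     + (1 + r / s) * Normc.normc (Phi k << y, X i >>) ^+ 2))).
  apply: ler_sum => i _; rewrite innerDl linearD /=.
  set a := Normc.normc (Phi k << x, X i >>).
  set b := Normc.normc (Phi k << y, X i >>).
  apply: (@le_trans _ _ ((a + b) ^+ 2)).
    rewrite lerXn2r ?nnegrE ?addr_ge0 ?normc_nonneg ?le_normcD//.
  rewrite -subr_ge0 (_ : _ - _ = (s * a - r * b) ^+ 2 / (r * s)).
    by rewrite divr_ge0 ?sqr_ge0 ?mulr_ge0// ltW.
  by field; rewrite !gt_eqF.
rewrite big_split /= -!mulr_sumr.
apply: (@le_trans _ _ ((1 + s / r) * r ^+ 2 + (1 + r / s) * s ^+ 2)).
  by apply: lerD; rewrite ler_wpM2l// addr_ge0// divr_ge0// ltW.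
by rewrite le_eqVlt; apply/orP; left; apply/eqP; field; rewrite !gt_eqF.
Qed.

Lemma pXPhiZ X Phi x (t r : R) : 0 < t -> 0 <= r ->
  (pXPhi X Phi x <= r%:E)%E -> (pXPhi X Phi (t%:C%C *: x)%R <= (t * r)%:E)%E.
Proof.
move=> t0 r0 /(pXPhi_leP _ _ _ r0) hx.
apply/pXPhi_leP; first by rewrite mulr_ge0// ltW.
move=> k n; rewrite exprMn.
have -> : \sum_(k <= i < n) Normc.normc (Phi k << t%:C%C *: x, X i >>) ^+ 2 =
    t ^+ 2 * \sum_(k <= i < n) Normc.normc (Phi k << x, X i >>) ^+ 2.
  rewrite mulr_sumr; apply: eq_bigr => i _; rewrite innerZl scE linearZ /=.
  by rewrite Normc.normcM normc_real exprMn gtr0_norm.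
by rewrite ler_wpM2l// sqr_ge0.
Qed.

Lemma state_sum_le phi X x k n : state phi ->
  \sum_(k <= i < n) Normc.normc (phi << x, X i >>) ^+ 2 <=
  rnorm (qframe (fun i => X (k + i)%N) (n - k) x).
Proof.
move=> sphi; apply: le_trans (normc_le_rnorm sphi _).
apply: le_trans (Re_le_normc _).
rewrite /qframe linear_sum /= raddf_sum /= -{1}[k]add0n big_addn big_mkord.
apply: ler_sum => i _; rewrite addnC -[<< X _, x >>]inner_star.
exact: state_cauchy_schwarz.
Qed.

Section Admissible.
Variables (X : nat -> M) (Phi : nat -> {scalar A}).
Hypotheses (aX : admissible X) (sPhi : forall k, state (Phi k)).
Local Notation p := (pXPhi X Phi).

Lemma admissible_cvg x : exists2 l, rcvg (bracket_series X x) l & psd (<< x, x >> - l).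
Proof.
have [cvgX leX] := aX.1 x; exists (limn (bracket_series X x)).
  exact/rcvgP.
exact: cpos_psd.
Qed.

Lemma admissible_qframe x m k :
  psd (<< x, x >> - qframe (fun i => X (m + i)%N) k x).
Proof.
have [l ul pl] := admissible_cvg x.
have pn n : psd (l - bracket_series X x n).
  apply: (psd_closed (u := fun k => bracket_series X x (n + k) - bracket_series X x n)).
    by move=> j; rewrite bracket_series_tail; exact: psd_qframe.
  apply: (rcvg_lip (f := fun b => b - bracket_series X x n)
    (u := fun k => bracket_series X x (n + k)) (C := 1)).
    move=> j; rewrite mul1r opprD opprK addrACA [- _ + _]addrC subrr addr0.
    exact: lexx.
  move=> e /ul[N HN]; exists N => j Nj; apply: HN.
  by rewrite (leq_trans Nj)// leq_addl.
rewrite -bracket_series_tail (_ : _ - _ = (<< x, x >> - l) +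
  ((l - bracket_series X x (m + k)) + bracket_series X x m)); last by ncring.
apply: psdD => //; apply: psdD => //.
by rewrite bracket_seriesE; exact: psd_qframe.
Qed.

Lemma admissible_tail_small x : tail_small X x.
Proof.
have [l ul _] := admissible_cvg x => e e0.
have e2 : 0 < e / 2 by rewrite divr_gt0.
have [N HN] := ul _ e2; exists N => m k Nm; rewrite -bracket_series_tail.
apply: le_trans (rnorm_triangle l _ _) _; rewrite [X in _ + X]rnormBC.
have := HN _ Nm; have := HN _ (leq_trans Nm (leq_addr k m)); lra.
Qed.

Lemma pXPhi_le_norm x : (p x <= (rnorm x)%:E)%E.
Proof.
apply/pXPhi_leP; first exact: rnorm_ge0.
move=> k n; apply: le_trans (state_sum_le _ _ _ _ (sPhi k)) _.
rewrite -rnorm_inner; apply: psd_norm_le; first exact: psd_qframe.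
exact: admissible_qframe.
Qed.

(** Total boundedness of [{x a : rnorm a <= C}]. Convergence of the bracket series
    at [x] makes all but finitely many of the functionals
    [a |-> Phi_k <x a, X_i>], [k <= i], negligible together; the values of the
    remaining ones are sorted into a finite grid. *)
Lemma rank1_totally_bounded x (C eta : R) : 0 < eta ->
  exists ys : seq M, forall a, rnorm a <= C ->
    exists2 y, y \in ys & (p (x ** a - y)%R <= eta%:E)%E.
Proof.
move=> eta0; pose B := `|C| + 1; have B0 : 0 < B by rewrite ltr_wpDl.
pose e0 := eta ^+ 2 / (8 * B ^+ 2).
have e00 : 0 < e0 by rewrite divr_gt0// ?mulr_gt0// exprn_gt0.
have [K HK] := admissible_tail_small x e00.
pose e1 := eta / (2 * K.+1%:R).
have e10 : 0 < e1 by rewrite divr_gt0// mulr_gt0.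
pose D := rnorm x * B.
have D0 : 0 <= D by rewrite mulr_ge0 ?rnorm_ge0// ltW.
pose h a (k i : nat) := Phi k << x ** a, X i >>.
pose grid a := [ffun ki : 'I_K * 'I_K =>
  (grid_cell D e1 (complex.Re (h a ki.1 ki.2)),
   grid_cell D e1 (complex.Im (h a ki.1 ki.2)))].
have hD a k i : rnorm a <= C -> Normc.normc (h a k i) <= D.
  move=> aC; apply: le_trans (normc_le_rnorm (sPhi k) _) _.
  apply: le_trans (rnorm_inner_le _ _) _; rewrite -[leRHS]mulr1.
  apply: ler_pM; rewrite ?rnorm_ge0 ?(aX.2)//.
  apply: le_trans (rnorm_ract _ _) _; rewrite ler_wpM2l ?rnorm_ge0//.
  by rewrite (le_trans aC)// /B; have := ler_norm C; lra.
have [rep Hrep] := finite_representatives grid (fun a => rnorm a <= C) 0.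
exists [seq x ** rep j | j <- enum {: {ffun 'I_K * 'I_K -> _}}] => a aC.
exists (x ** rep (grid a)); first by apply: map_f; rewrite mem_enum.
have [] := Hrep _ aC; set b := rep (grid a) => bC gab.
pose F k i := Normc.normc (Phi k << x ** a - x ** b, X i >>) ^+ 2.
have F0 k i : 0 <= F k i by exact: sqr_ge0.
have FE k i : F k i = Normc.normc (h a k i - h b k i) ^+ 2.
  by rewrite /F innerBl linearB.
have tail k m n : (K <= m)%N -> \sum_(m <= i < n) F k i <= eta ^+ 2 / 2.
  move=> Km; apply: le_trans (state_sum_le _ _ _ _ (sPhi k)) _.
  have -> : x ** a - x ** b = x ** (a - b).
    by apply/eqP; rewrite subr_eq -ractDr subrK.
  apply: le_trans (rnorm_qframe_ract _ _ _ _) _.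
  apply: (@le_trans _ _ ((2 * B) ^+ 2 * e0)).
    apply: ler_pM; rewrite ?sqr_ge0 ?rnorm_ge0 ?HK//.
    rewrite lerXn2r ?nnegrE ?rnorm_ge0// ?mulr_ge0// ?ltW//.
    apply: le_lt_trans (rnormB _ _) _; rewrite /B.
    by have := ler_norm C; lra.
  by rewrite le_eqVlt; apply/orP; left; apply/eqP; rewrite /e0; field;
    rewrite gt_eqF.
have head k i : (k < K)%N -> (i < K)%N -> F k i <= 2 * e1 ^+ 2.
  move=> kK iK; have := congr1 (fun g : {ffun _ -> _} => g (Ordinal kK, Ordinal iK)) gab.
  rewrite !ffunE /= => -[cRe cIm]; rewrite FE normc_sq.
  have dRe := grid_cell_dist e10 (le_trans (normr_Re_le _) (hD _ k i bC))
    (le_trans (normr_Re_le _) (hD _ k i aC)) cRe.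
  have dIm := grid_cell_dist e10 (le_trans (normr_Im_le _) (hD _ k i bC))
    (le_trans (normr_Im_le _) (hD _ k i aC)) cIm.
  have sq (u v w : R) : `|u - v| < w -> (v - u) ^+ 2 <= w ^+ 2.
    move=> uv; rewrite -(real_normK (num_real (v - u))) distrC.
    by rewrite lerXn2r ?nnegrE ?normr_ge0// ltW// (le_lt_trans _ uv).
  by rewrite !raddfB /= mulr_natl mulr2n lerD// sq.
have headsum k n : (k < K)%N -> (n <= K)%N -> \sum_(k <= i < n) F k i <= eta ^+ 2 / 2.
  move=> kK nK; apply: (@le_trans _ _ (\sum_(k <= i < n) 2 * e1 ^+ 2)).
    rewrite big_nat_cond [leRHS]big_nat_cond; apply: ler_sum => i.
    rewrite andbT => /andP[_ ilt]; apply: head => //; exact: leq_trans nK.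
  rewrite sumr_const_nat -[leLHS]mulr_natl.
  apply: (@le_trans _ _ (K.+1%:R * (2 * e1 ^+ 2))).
    apply: ler_wpM2r; first by rewrite mulr_ge0// sqr_ge0.
    by rewrite ler_nat (leq_trans (leq_subr _ _))// (leq_trans nK).
  have K1 : 1 <= K.+1%:R :> R by rewrite ler1n.
  have -> : K.+1%:R * (2 * e1 ^+ 2) = eta ^+ 2 / 2 / K.+1%:R.
    by rewrite /e1; field; rewrite addrC natr1 gt_eqF.
  by rewrite ler_pdivrMr// ler_peMr// divr_ge0 ?sqr_ge0.
apply/pXPhi_leP; first exact: ltW.
move=> k n; have [Kk|kK] := leqP K k.
  by apply: le_trans (tail k k n Kk) _; rewrite ler_pdivrMr// ler_peMr ?sqr_ge0// ler1n.
have [nK|Kn] := leqP n K.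
  by apply: le_trans (headsum k n kK nK) _; rewrite ler_pdivrMr// ler_peMr ?sqr_ge0// ler1n.
have cut : \sum_(k <= i < n) F k i =
    \sum_(k <= i < K) F k i + \sum_(K <= i < n) F k i.
  by apply: big_cat_nat; exact: ltnW.
suff : \sum_(k <= i < n) F k i <= eta ^+ 2 by [].
rewrite cut [leRHS]splitr.
exact: lerD (headsum k K kK (leqnn _)) (tail k K n (leqnn _)).
Qed.

Lemma finite_rank_totally_bounded (f : nat -> M) n (C eta : R) : 0 < eta ->
  exists ys : seq M, forall a : nat -> A, (forall i, (i < n)%N -> rnorm (a i) <= C) ->
    exists2 y, y \in ys & (p (\sum_(i < n) f i ** a i - y)%R <= eta%:E)%E.
Proof.
elim: n eta => [|n IH] eta eta0.
  exists [:: 0] => a _; exists 0; first exact: mem_head.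
  rewrite big_ord0 subrr; apply: le_trans (pXPhi_le_norm _) _.
  by rewrite rnorm0 lee_fin ltW.
have e2 : 0 < eta / 2 by rewrite divr_gt0.
have [ys Hys] := IH _ e2; have [zs Hzs] := rank1_totally_bounded (f n) C e2.
exists [seq y + z | y <- ys, z <- zs] => a aC.
have [y yin yp] := Hys a (fun i ilt => aC i (ltnW ilt)).
have [z zin zp] := Hzs (a n) (aC n (ltnSn n)).
exists (y + z); first by apply: allpairs_f.
rewrite big_ord_recr /= opprD addrACA [eta]splitr.
exact: pXPhi_add.
Qed.

(** Points of [E] detected at every index cannot be covered by smaller balls. *)
Lemma chi_ge_detected (E : set M) (r : R) :
  (forall k, exists2 x, E x & r <= complex.Re (Phi k << x, X k >>)) ->
  (r%:E <= chi p E)%E.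
Proof.
move=> detect; apply: le_ereal_inf_tmp => _ [e [e0 [ys cov]] <-].
rewrite lee_fin; apply/ler_addgt0Pr => d d0.
have small y : exists K, forall k, (K <= k)%N -> rnorm << X k, y >> <= d.
  have [K HK] := admissible_tail_small y (exprn_gt0 2 d0); exists K => k Kk.
  rewrite -(ler_pXn2r (n := 2)) ?nnegrE ?rnorm_ge0 ?(ltW d0)//.
  apply: le_trans (HK k 1%N Kk).
  by rewrite /qframe big_ord1 addn0 -[<< y, _ >>]inner_star rnorm_starM.
have [K HK] : exists K, forall y, y \in ys -> rnorm << X K, y >> <= d.
  suff [K HK] : exists K, forall y, y \in ys -> forall k, (K <= k)%N ->
      rnorm << X k, y >> <= d by exists K => y yin; exact: HK.
  elim: (ys) => [|z zs [K HK]]; first by exists 0%N.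
  have [N HN] := small z; exists (maxn N K) => y; rewrite inE.
  move=> /predU1P[->|yin] k; rewrite geq_max => /andP[Nk Kk]; first exact: HN.
  exact: HK.
have [x Ex rx] := detect K; have [y yin /ltW] := cov _ Ex.
move=> /(pXPhi_leP _ _ _ (ltW e0))/(_ K K.+1); rewrite big_nat1.
rewrite ler_pXn2r ?nnegrE ?normc_nonneg ?(ltW e0)// => h.
apply: le_trans rx _; rewrite -[x](subrK y) innerDl linearD /= raddfD /=.
apply: lerD; first exact: le_trans (Re_le_normc _) h.
apply: le_trans (Re_le_normc _) _; apply: le_trans (normc_le_rnorm (sPhi _) _) _.
by rewrite rnorm_innerC HK.
Qed.

End Admissible.
End Seminorm.

(** * The Hausdorff measure and operators *)

Section HausdorffMeasure.
Context {R : realType} {A : cstarAlgType R} {M : hilbertModType A}.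
Implicit Types (x y z u v w : M) (E : set M) (X : nat -> M).
Implicit Types (Phi : nat -> {scalar A}).

Local Notation "x ** a" := (@ract R A M x a) (at level 40).
Local Notation unit_ball := [set x : M | rnorm x <= 1].

Lemma chi_ge0 (p : M -> \bar R) E : (0 <= chi p E)%E.
Proof. by apply: le_ereal_inf_tmp => _ [e [e0 _] <-]; rewrite lee_fin ltW. Qed.

Lemma chi_le_chi_star X Phi E : admissible X -> (forall k, state (Phi k)) ->
  (chi (pXPhi X Phi) E <= chi_star E)%E.
Proof. by move=> aX sPhi; apply: ereal_sup_ubound; exists X, Phi. Qed.

Lemma chi_star_le E (r : \bar R) :
  (forall X Phi, admissible X -> (forall k, state (Phi k)) ->
    (chi (pXPhi X Phi) E <= r)%E) -> (chi_star E <= r)%E.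
Proof. by move=> h; apply: ge_ereal_sup => _ [X [Phi [aX sPhi ->]]]; exact: h. Qed.

Lemma chi_star_ge0 E : (0 <= chi_star E)%E.
Proof.
have [phi [sphi _]] := exists_state (psd_sc (A := A) ler01).
have z1 : gram_le1 (fun=> 0 : M).
  by move=> n i; rewrite big1 // => j _; rewrite inner0r rnorm0.
apply: le_trans (chi_ge0 (pXPhi (fun=> 0) (fun=> phi)) E) _.
apply: chi_le_chi_star => //; apply: tail_small_admissible => // x e e0.
exists 0%N => m k _; rewrite /qframe big1 ?rnorm0 ?ltW// => i _.
by rewrite inner0r mul0r.
Qed.

Lemma chi_star_le_bound E (B : R) : 0 <= B -> (forall x, E x -> rnorm x <= B) ->
  (chi_star E <= B%:E)%E.
Proof.
move=> B0 EB; apply: chi_star_le => X Phi aX sPhi.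
apply/lee_addgt0Pr => e e0; rewrite -EFinD; apply: ereal_inf_lbound.
exists (B + e) => //; split; first by rewrite ltr_wpDl.
exists [:: 0] => x Ex; exists 0; first exact: mem_head.
rewrite subr0; apply: le_lt_trans (pXPhi_le_norm aX sPhi x) _.
by rewrite lte_fin ltr_pwDr// EB.
Qed.

Lemma chi_lt_cover (p : M -> \bar R) E (e : R) : (chi p E < e%:E)%E ->
  exists ys : seq M, forall x, E x -> exists2 y, y \in ys & (p (x - y)%R <= e%:E)%E.
Proof.
move=> /ereal_inf_lt[_ [d [d0 [ys cov]] <-] de]; exists ys => x /cov[y yin xy].
by exists y => //; rewrite ltW// (lt_trans xy).
Qed.

(** A bounded set of measure less than [r] is within [r] of a finitely generated
    piece of the module. *)
Lemma chi_star_lt_approximable E (Bd r : R) : countably_generated M ->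
  (forall x, E x -> rnorm x <= Bd) -> (chi_star E < r%:E)%E -> approximable r E.
Proof.
move=> gM EB Er; apply: contrapT => nE.
have r0 : 0 < r by rewrite -lte_fin (le_lt_trans (chi_star_ge0 E)).
have sE : chi_star E \is a fin_num.
  by rewrite fin_real// (lt_trans Er) ?ltry// andbT (lt_le_trans _ (chi_star_ge0 E)).
have := chi_star_ge0 E; rewrite -(fineK sE) lee_fin in Er *.
move: Er; rewrite lte_fin; set s := fine _ => sr s0.
(* the losses in the construction are chosen so that [r] decreases to the
   midpoint [t] of [s] and [r] *)
pose t := (s + r) / 2; have t0 : 0 < t by rewrite divr_gt0// ltr_wpDl.
have tr : t < r by rewrite ltr_pdivrMr//; lra.
pose d := (r / t) ^+ 2 - 1.
have d0 : 0 < d.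
  by rewrite subr_gt0 exprn_egt1// ltr_pdivlMr// mul1r.
have [X [Phi [aX sPhi hX]]] := exists_detecting_system gM EB r0 nE d0.
have := le_trans (chi_ge_detected aX sPhi hX) (chi_le_chi_star E aX sPhi).
rewrite -(fineK sE) lee_fin -/s /d addrC subrK sqrtr_sqr ger0_norm.
  by rewrite invf_div mulrCA divff ?gt_eqF// mulr1 /t; lra.
by rewrite divr_ge0// ltW.
Qed.

Section Operator.
Variable T : M -> M.
Hypothesis TD : forall x y, T (x + y) = T x + T y.
Hypothesis TA : forall x a, T (x ** a) = T x ** a.

Lemma moduleop_scale (t : R) x : T (t%:C%C *: x) = t%:C%C *: T x.
Proof. by rewrite -!ract_sc TA. Qed.

Lemma moduleop_sum n (f : 'I_n -> M) : T (\sum_(i < n) f i) = \sum_(i < n) T (f i).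
Proof.
have T0 : T 0 = 0 by apply: (addrI (T 0)); rewrite -TD !addr0.
by elim/big_ind2: _ => [|y u z v <- <-|//]; [exact: T0 | exact: TD].
Qed.

(** If [E] lies within [r] of a piece of a finitely generated submodule, then
    [T E] lies in the sum of a set that is totally bounded for every
    [pXPhi X Phi] and of [r] times the image of the unit ball. *)
Lemma chi_image_approximable E X Phi (l r : R) :
  admissible X -> (forall k, state (Phi k)) -> 0 <= l -> 0 < r ->
  (chi_star (T @` unit_ball) <= l%:E)%E -> approximable r E ->
  (chi (pXPhi X Phi) (T @` E) <= (l * r)%:E)%E.
Proof.
move=> aX sPhi l0 r0 Tl [n [f [C Ef]]].
apply/lee_addgt0Pr => e e0; rewrite -EFinD.
pose d := e / (2 * r); have d0 : 0 < d by rewrite divr_gt0// mulr_gt0.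
have ld0 : 0 < l + d by rewrite ltr_wpDl.
have [ys Hys] : exists ys : seq M, forall x, (T @` unit_ball) x ->
    exists2 y, y \in ys & (pXPhi X Phi (x - y)%R <= (l + d)%:E)%E.
  apply: chi_lt_cover; apply: le_lt_trans (chi_le_chi_star _ aX sPhi) _.
  by apply: le_lt_trans Tl _; rewrite lte_fin ltrDl.
have e4 : 0 < e / 4 by rewrite divr_gt0.
have [zs Hzs] := finite_rank_totally_bounded aX sPhi (fun i => T (f i)) n C e4.
apply: ereal_inf_lbound; exists (l * r + e) => //; split.
  by rewrite ltr_wpDl// mulr_ge0// ltW.
exists [seq z + r%:C%C *: y | z <- zs, y <- ys] => _ [x Ex <-].
have [a [aC xa]] := Ef _ Ex.
pose u := x - \sum_(i < n) f i ** a i; pose v := (r^-1)%:C%C *: u.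
have v1 : rnorm v <= 1.
  by rewrite rnormZr gtr0_norm ?invr_gt0// ler_pdivrMl// mulr1.
have Tx : T x = \sum_(i < n) T (f i) ** a i + r%:C%C *: T v.
  rewrite -moduleop_scale /v scalerA -rmorphM divff ?gt_eqF// scale1r.
  under eq_bigr do rewrite -TA.
  by rewrite -moduleop_sum -TD /u addrC subrK.
have [z zin zp] := Hzs a aC.
have [y yin yp] := Hys (T v) (ex_intro2 _ _ v v1 erefl).
exists (z + r%:C%C *: y); first by apply: allpairs_f.
have -> : T x - (z + r%:C%C *: y) =
    (\sum_(i < n) T (f i) ** a i - z) + r%:C%C *: (T v - y).
  by rewrite Tx scalerBr opprD addrACA.
have h := pXPhiZ r0 (ltW ld0) yp.
apply: le_lt_trans (pXPhi_add e4 (mulr_gt0 r0 ld0) zp h) _.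
rewrite lte_fin (_ : r * (l + d) = l * r + e / 2); first lra.
by rewrite /d; field; rewrite gt_eqF.
Qed.

Lemma chi_star_image_le E (Bd l : R) : countably_generated M ->
  (forall x, E x -> rnorm x <= Bd) -> 0 <= l ->
  (chi_star (T @` unit_ball) <= l%:E)%E ->
  (chi_star (T @` E) <= l%:E * chi_star E)%E.
Proof.
move=> gM EB l0 Tl; apply: chi_star_le => X Phi aX sPhi.
have Ele : (chi_star E <= (`|Bd|)%:E)%E.
  apply: chi_star_le_bound => // x /EB h; exact: le_trans h (ler_norm _).
have sE : chi_star E \is a fin_num.
  by rewrite fin_real// (le_lt_trans Ele) ?ltry// andbT (lt_le_trans _ (chi_star_ge0 E)).
have := chi_star_ge0 E; rewrite -(fineK sE) lee_fin; set s := fine _ => s0.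
rewrite -EFinM; apply/lee_addgt0Pr => e e0; rewrite -EFinD.
pose d := e / (l + 1); have l1 : 0 < l + 1 by rewrite ltr_wpDl.
have d0 : 0 < d by rewrite divr_gt0.
have Er : (chi_star E < (s + d)%:E)%E by rewrite -(fineK sE) lte_fin ltrDl.
have aE := chi_star_lt_approximable gM EB Er.
have sd0 : 0 < s + d by rewrite ltr_wpDl.
apply: le_trans (chi_image_approximable aX sPhi l0 sd0 Tl aE) _.
rewrite lee_fin mulrDr lerD2l /d mulrCA ger_pMr// ler_pdivrMr//.
by rewrite mul1r lerDl.
Qed.

End Operator.
End HausdorffMeasure.

Unset Implicit Arguments.
Set Strict Implicit.
Set Printing Implicit Defensive.

Theorem proposition3p16 (R : realType) (A : cstarAlgType R)
    (M : hilbertModType A) (hM : countably_generated M)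
    (T : M -> M) (hT : bounded_adjointable T) :
  chi_o_star T =
  ereal_inf [set k%:E | k in [set k : R | 0 <= k /\
    forall E : set M, bounded_set E ->
      (chi_star (T @` E) <= k%:E * chi_star E)%E]].
Proof.
have [TD TA [C TC] _] := hT.
have To0 : (0 <= chi_o_star T)%E by exact: chi_star_ge0.
have ToC : (chi_o_star T <= (`|C|)%:E)%E.
  apply: chi_star_le_bound => // _ [x /= x1 <-]; apply: le_trans (TC x) _.
  apply: le_trans (ler_norm _) _; rewrite normrM (ger0_norm (rnorm_ge0 _)).
  by rewrite ler_piMr.
have ToE : chi_o_star T \is a fin_num.
  by rewrite fin_real// (le_lt_trans ToC) ?ltry// andbT (lt_le_trans _ To0).
apply/eqP; rewrite eq_le; apply/andP; split.
  apply: le_ereal_inf_tmp => _ [k [k0 hk] <-].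
  have ball_bounded : bounded_set [set x : M | rnorm x <= 1].
    exists 1; split; first exact: real1.
    move=> m m1 x /= x1; rewrite (le_trans _ (ltW m1))//.
    by rewrite normE_rnorm lecR.
  apply: le_trans (hk _ ball_bounded) _; rewrite -[leRHS]mule1.
  apply: lee_wpmul2l; first by rewrite lee_fin.
  exact: chi_star_le_bound.
rewrite -(fineK ToE); apply: ereal_inf_lbound; exists (fine (chi_o_star T)) => //.
have l0 : 0 <= fine (chi_o_star T) by exact: fine_ge0.
split=> // E [m [_ hm]].
have EB x : E x -> rnorm x <= complex.Re (m + 1).
  move=> Ex; have := hm (m + 1); rewrite ltrDl ltr01 => /(_ isT x Ex) /=.
  by rewrite normE_rnorm lecE /= => /andP[].
apply: (chi_star_image_le TD TA hM EB l0).
by rewrite fineK.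
Qed.
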